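(* Let $n\geq 2$ and $c\neq0$. There do not exist real hypersurfaces $M$ in the non-flat complex space form $M_n(c)$ whose structure vector field $\xi$ belongs to the $(\kappa,\mu,\nu)$-nullity distribution with $\kappa,\mu,\nu$ non-constant smooth functions on $M$; that is, there is no real hypersurface $M$ in $M_n(c)$ together with non-constant smooth functions $\kappa,\mu,\nu$ on $M$ such that $$R(X,Y)\xi=\kappa[\eta(Y)X-\eta(X)Y]+\mu[\eta(Y)AX-\eta(X)AY]+\nu[\eta(Y)\varphi AX-\eta(X)\varphi AY]$$ for all tangent vector fields $X,Y$ on $M$.
   Context: $M_n(c)$ with $c\neq0$ denotes a non-flat complex space form of complex dimension $n$ and constant holomorphic sectional curvature $c$: complex projective space $\mathbb{C}P^n$ if $c>0$, complex hyperbolic space $\mathbb{C}H^n$ if $c<0$, with complex structure $J$ and Kähler metric $G$. All manifolds and vector fields are $C^\infty$ and all manifolds are connected. A real hypersurface $M$ is an immersed submanifold of real codimension one, without boundary, with a unit normal vector field $N$ and induced metric $g$. The structure vector field is $\xi=-JN$, and $\eta(X)=g(X,\xi)$; the structure tensor $\varphi$ is defined by $JX=\varphi X+\eta(X)N$, with $\varphi X$ the tangential component of $JX$. The shape operator $A$ is given by $AX=-\overline{\nabla}_XN$, where $\overline\nabla$ is the Levi-Civita connection of $M_n(c)$. $R$ is the Riemannian curvature tensor of $(M,g)$, with the convention $R(X,Y)Z=\nabla_X\nabla_YZ-\nabla_Y\nabla_XZ-\nabla_{[X,Y]}Z$. The $(\kappa,\mu,\nu)$-nullity distribution assigns to each $P\in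 M$ the set $N_P(\kappa,\mu,\nu)$ of all $Z\in T_PM$ such that $R(X,Y)Z=\kappa[\eta(Y)X-\eta(X)Y]+\mu[\eta(Y)AX-\eta(X)AY]+\nu[\eta(Y)\varphi AX-\eta(X)\varphi AY]$ for all $X,Y\in T_PM$. *)

(* Defs.v *)
From HB Require Import structures.
From mathcomp Require Import all_boot all_order all_algebra.
From mathcomp Require Import all_classical all_reals all_analysis.
From mathcomp Require Import complex.
Set Implicit Arguments.
Unset Strict Implicit.
Unset Printing Implicit Defensive.
Import Order.TTheory GRing.Theory Num.Theory.
Import numFieldNormedType.Exports.
Local Open Scope classical_set_scope.
Local Open Scope complex_scope.
Local Open Scope ring_scope.

(** * Smooth functions, atlases and smooth maps

    Tangent vectors are row vectors, so that the differential of [F] at [u] is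
    [v |-> v *m jacobian F u]. *)

(* [Ck k U f]: [f] is of class C^k on the open set [U]. *)
Fixpoint Ck (R : realType) (m : nat) (V : normedModType R) (k : nat)
    (U : set 'rV[R]_m) (f : 'rV[R]_m -> V) : Prop :=
  match k with
  | 0%N => forall x, U x -> {for x, continuous f}
  | k'.+1 => (forall x, U x -> differentiable f x) /\
      forall i : 'I_m, Ck k' U (fun x => 'D_(delta_mx 0 i) f x)
  end.

Definition smooth_on (R : realType) (m : nat) (V : normedModType R)
    (U : set 'rV[R]_m) (f : 'rV[R]_m -> V) : Prop :=
  forall k, Ck k U f.

(* An atlas is given by its local parametrizations (the inverses of the usual
   charts); only the values of [param i] on [dom i] matter. *)
Record atlas (R : realType) (m : nat) (T : Type) := Atlas {
  chart : Type;
  dom : chart -> set 'rV[R]_m;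
  param : chart -> 'rV[R]_m -> T }.

Arguments dom {R m T} a _ _.
Arguments param {R m T} a _ _.

Definition chart_image (R : realType) (m : nat) (T : Type) (X : atlas R m T)
    (i : chart X) : set T :=
  param X i @` dom X i.

Definition coord (R : realType) (m : nat) (T : Type) (X : atlas R m T)
    (i : chart X) : T -> 'rV[R]_m :=
  'pinv_(fun=> 0) (dom X i) (param X i).

Section Maps.
Variables (R : realType) (m k : nat) (T S : Type).
Variables (X : atlas R m T) (Y : atlas R k S) (f : T -> S).

(* The expression of [f] in the charts [i] and [j], and its domain. *)
Definition locdom (i : chart X) (j : chart Y) : set 'rV[R]_m :=
  dom X i `&` [set u | chart_image j (f (param X i u))].

Definition locrep (i : chart X) (j : chart Y) : 'rV[R]_m -> 'rV[R]_k :=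
  fun u => coord j (f (param X i u)).

Definition smooth_map : Prop := forall (i : chart X) (j : chart Y),
  open (locdom i j) /\ smooth_on (locdom i j) (locrep i j).

(* A smooth field along [f] of tangent vectors of the target: [W j P] is the
   row of components in the chart [j] of a tangent vector at [f P]; it is
   meaningful only if [f P] lies in the image of the chart [j]. *)
Definition field_along (W : chart Y -> T -> 'rV[R]_k) : Prop :=
  (forall (j j' : chart Y) (P : T),
     chart_image j (f P) -> chart_image j' (f P) ->
     W j' P = 'D_(W j P) (fun y => coord j' (param Y j y)) (coord j (f P))) /\
  (forall (i : chart X) (j : chart Y),
     smooth_on (locdom i j) (fun u => W j (param X i u))).

End Maps.

Definition smooth_fun (R : realType) (m : nat) (T : Type) (X : atlas R m T)
    (h : T -> R) : Prop :=
  forall i : chart X, smooth_on (dom X i) (fun u => h (param X i u) : R^o).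

Definition nonconstant (T U : Type) (h : T -> U) : Prop :=
  exists P Q, h P <> h Q.

(* The parametrizations are homeomorphisms onto open sets that cover [T], with
   smooth coordinate changes. *)
Definition is_manifold (R : realType) (m : nat) (T : topologicalType)
    (X : atlas R m T) : Prop :=
  [/\ hausdorff_space T,
      @second_countable T,
      forall P : T, exists i : chart X, chart_image i P,
      forall i : chart X, [/\ open (dom X i),
        set_inj (dom X i) (param X i),
        forall U : set T, open U -> open (dom X i `&` param X i @^-1` U)
        & forall D : set 'rV[R]_m,
            open D -> D `<=` dom X i -> open (param X i @` D)]
    & smooth_map X X id].

(** * Riemannian geometry in a coordinate domain of R^m

    A metric is given by its Gram matrices [g x]; vector fields are functions
    from R^m to R^m. *)

Section Riemann.
Variables (R : realType) (m : nat).
Implicit Types (g : 'rV[R]_m -> 'M[R]_m) (X Y Z : 'rV[R]_m -> 'rV[R]_m).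

Definition ip (G : 'M[R]_m) (v w : 'rV[R]_m) : R := (v *m G *m w^T) 0 0.

Definition pd (i : 'I_m) (h : 'rV[R]_m -> R) (x : 'rV[R]_m) : R :=
  'D_(delta_mx 0 i) (h : 'rV[R]_m -> R^o) x.

(* The Christoffel symbol with upper index [l] and lower indices [i], [j]. *)
Definition christoffel g (x : 'rV[R]_m) (l i j : 'I_m) : R :=
  2^-1 * \sum_s invmx (g x) l s *
    (pd i (fun y => g y j s) x + pd j (fun y => g y i s) x
       - pd s (fun y => g y i j) x).

Definition Gam g (x v w : 'rV[R]_m) : 'rV[R]_m :=
  \row_l \sum_i \sum_j christoffel g x l i j * v 0 i * w 0 j.

(* The Levi-Civita connection. *)
Definition nabla g X Y : 'rV[R]_m -> 'rV[R]_m :=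
  fun x => 'D_(X x) Y x + Gam g x (X x) (Y x).

Definition lie X Y : 'rV[R]_m -> 'rV[R]_m :=
  fun x => 'D_(X x) Y x - 'D_(Y x) X x.

Definition curv g X Y Z : 'rV[R]_m -> 'rV[R]_m :=
  fun x => nabla g X (nabla g Y Z) x - nabla g Y (nabla g X Z) x
           - nabla g (lie X Y) Z x.

(* [curv] is tensorial: its value at [x] depends only on the values of the
   three fields at [x], so these may be extended as constant fields. *)
Definition riem g (x v w z : 'rV[R]_m) : 'rV[R]_m :=
  curv g (fun=> v) (fun=> w) (fun=> z) x.

End Riemann.

(** * Hypersurfaces in local coordinates

    [F] is an immersion of an open set of R^m into C^n = R^(n + n), on which the
    ambient metric is [G] and the complex structure is multiplication by i;
    [N] is a unit normal field along [F]. *)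

Section Hypersurface.
Variables (R : realType) (n m : nat).
Variables (G : 'rV[R]_(n + n) -> 'M[R]_(n + n)).
Variables (F N : 'rV[R]_m -> 'rV[R]_(n + n)).
Implicit Types (u v : 'rV[R]_m) (w : 'rV[R]_(n + n)).

(* (x, y) stands for x + i y. *)
Definition cstruct w : 'rV[R]_(n + n) := row_mx (- rsubmx w) (lsubmx w).

Definition indmet u : 'M[R]_m :=
  jacobian F u *m G (F u) *m (jacobian F u)^T.

(* The vector whose image by the differential of [F] at [u] is the orthogonal
   projection of [w] on the tangent space of the hypersurface. *)
Definition tang u w : 'rV[R]_m :=
  w *m G (F u) *m (jacobian F u)^T *m invmx (indmet u).

(* The ambient Levi-Civita connection, acting on fields along [F]. *)
Definition nabla_along v (W : 'rV[R]_m -> 'rV[R]_(n + n)) u : 'rV[R]_(n + n) :=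
  'D_v W u + Gam G (F u) (v *m jacobian F u) (W u).

Definition shape u v : 'rV[R]_m := tang u (- nabla_along v N u).

Definition xi u : 'rV[R]_m := tang u (- cstruct (N u)).

Definition eta u v : R := ip (indmet u) v (xi u).

Definition phi u v : 'rV[R]_m := tang u (cstruct (v *m jacobian F u)).

Definition nullity (kappa mu nu : R) u : set 'rV[R]_m :=
  [set z | forall v w : 'rV[R]_m,
     riem indmet u v w z =
       kappa *: (eta u w *: v - eta u v *: w)
       + mu *: (eta u w *: shape u v - eta u v *: shape u w)
       + nu *: (eta u w *: phi u (shape u v) - eta u v *: phi u (shape u w))].

End Hypersurface.

(** * The complex space form of complex dimension n and constant holomorphic
    sectional curvature c <> 0

    Its points are the complex lines of C^(n+1) on which the Hermitian form
      |z_0|^2 + sg(c) (|z_1|^2 + ... + |z_n|^2)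
    is positive: all lines if c > 0 (complex projective space), and a copy of
    the unit ball of C^n if c < 0 (complex hyperbolic space). *)

Section SpaceForm.
Variables (R : realType) (c : R) (n : nat).
Implicit Types (z w : 'rV[R[i]]_n.+1).

Definition herm z w : R[i] :=
  \sum_k (if k == ord0 then 1 else (Num.sg c)%:C) * z 0 k * (w 0 k)^*.

Definition line z : set 'rV[R[i]]_n.+1 := [set a *: z | a in [set: R[i]]].

Definition space_form : Type :=
  {L : set 'rV[R[i]]_n.+1 | exists z, 0 < herm z z /\ L = line z}.

Lemma herm_delta0 : 0 < herm (delta_mx 0 ord0) (delta_mx 0 ord0).
Proof.
rewrite /herm big_ord_recl /= big1 ?addr0 => [|i _].
  by rewrite mxE !eqxx /= !mul1r conjC1 ltr01.
by rewrite mxE /= mulr0 mul0r.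
Qed.

Definition point_of_line z (hz : 0 < herm z z) : space_form :=
  exist _ (line z) (ex_intro _ z (conj hz erefl)).

(* The line through [z], with a default value if [z] is not positive. *)
Definition mkpoint z : space_form :=
  match pselect (0 < herm z z) with
  | left hz => point_of_line hz
  | right _ => point_of_line herm_delta0
  end.

(* The vector of C^(n+1) whose j-th component is [b] and whose other components
   are those of the vector [x] of C^n = R^(n + n). *)
Definition insert (j : 'I_n.+1) (b : R[i]) (x : 'rV[R]_(n + n)) :
    'rV[R[i]]_n.+1 :=
  \row_k (if unlift j k is Some l
          then x 0 (lshift n l) +i* x 0 (rshift n l) else b).

(* The n + 1 affine charts z_j = 1. *)
Definition space_form_atlas : atlas R (n + n) space_form :=
  @Atlas R (n + n) space_form 'I_n.+1
    (fun j => [set x | 0 < herm (insert j 1 x) (insert j 1 x)])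
    (fun j x => mkpoint (insert j 1 x)).

(* The Fubini-Study (c > 0) or Bergman (c < 0) metric at the line of [z],
     (4 / c) Re [(<z,z> <v,w> - <v,z> <z,w>) / <z,z>^2],
   read in the chart z_j = 1; it has holomorphic sectional curvature c. *)
Definition space_form_metric (j : 'I_n.+1) (x : 'rV[R]_(n + n)) :
    'M[R]_(n + n) :=
  \matrix_(a, b)
    let z := insert j 1 x in
    let v := insert j 0 (delta_mx 0 a) in
    let w := insert j 0 (delta_mx 0 b) in
    4 / c * complex.Re ((herm z z * herm v w - herm v z * herm z w)
                        / herm z z ^+ 2).

(* [f] is an immersion of the connected manifold [T] of dimension 2n - 1, and
   [N] is a global unit normal field along [f]. *)
Definition real_hypersurface (T : topologicalType) (X : atlas R n.*2.-1 T)
    (f : T -> space_form)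
    (N : chart space_form_atlas -> T -> 'rV[R]_(n + n)) : Prop :=
  let Y := space_form_atlas in
  [/\ is_manifold X,
      connected [set: T],
      smooth_map X Y f,
      field_along X f N
    & forall (i : chart X) (j : chart Y) (u : 'rV[R]_(n.*2.-1)),
        locdom f i j u ->
        let G := space_form_metric j (locrep f i j u) in
        let D := jacobian (locrep f i j) u in
        let Nu := N j (param X i u) in
        [/\ row_free D, forall v, ip G Nu (v *m D) = 0 & ip G Nu Nu = 1]].

(* At every point of the hypersurface, computed in any pair of charts around it
   and its image, [xi] lies in the (kappa, mu, nu)-nullity distribution. *)
Definition xi_in_nullity (T : topologicalType) (X : atlas R n.*2.-1 T)
    (f : T -> space_form) (N : chart space_form_atlas -> T -> 'rV[R]_(n + n))
    (kappa mu nu : T -> R) : Prop :=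
  let Y := space_form_atlas in
  forall (i : chart X) (j : chart Y) (u : 'rV[R]_(n.*2.-1)),
    locdom f i j u ->
    let P := param X i u in
    let G := space_form_metric j in
    let F := locrep f i j in
    let Nloc := fun u' => N j (param X i u') in
    nullity G F Nloc (kappa P) (mu P) (nu P) u (xi G F Nloc u).

End SpaceForm.

(* Main.v *)
Require Import Defs.
From HB Require Import structures.
From mathcomp Require Import all_boot all_order all_algebra.
From mathcomp Require Import all_classical all_reals all_analysis.
From mathcomp Require Import complex ring lra.

(** The obstruction comes from [nu] and is local. A nonconstant [nu] is nonzero
    at some point, hence on an open set around it, and no hypersurface satisfies
    the nullity condition with [nu] nowhere zero on a nonempty open set.

    Algebra at a point. Write [A] for the shape operator, [D] for the kernel of
    [eta] and [q = c / 4]. For tangent vectors the curvature tensor of the space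
    form gives, by the equation of Gauss ([gauss_xi]),
      [R(X, Y) xi = q (eta(Y) X - eta(X) Y) + eta(AY) AX - eta(AX) AY].
    Comparing this with the nullity condition for [X] and [Y] in [D], and for
    [Y = xi], leaves only linear algebra. If [V = A xi - eta(A xi) xi] is not
    zero, then [A] has rank one on [D] and one finds [nu = 0]; so [V = 0]
    ([hopf_of_nullity]). Then
      [(kappa - q) X + (mu - eta(A xi)) AX + nu phi(AX) = 0] on [D],
    where [A] is symmetric and [phi] is a skew complex structure. Separating the
    symmetric and the skew part gives [kappa = q], after which [A] vanishes on
    [D] because [(mu - eta(A xi)) + nu phi] is invertible. Hence
    [A X = eta(X) eta(A xi) xi] for all [X] ([shape_of_nullity]).

    Contradiction on the open set. Let [nabla] be the ambient connection along
    the hypersurface. The form of [A] says that [nabla_X N = theta(X) J N] for a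
    one-form [theta] ([nab_normal_J]). As [J] is parallel, differentiating once
    more and antisymmetrizing shows that the ambient curvature [Rbar(X, Y) N] is
    a multiple of [J N] for all tangent [X] and [Y]. But
    [Rbar(X, xi) N = q J X] for [X] in [D] ([sfcurv_normal]), and this is not a
    multiple of [J N] when [X <> 0]. Such an [X] exists since [n >= 2]
    ([no_nullity]).

    Computations. In the chart [z_j = 1] the Hermitian form of [C^(n+1)] becomes
    the real quadratic function [rho(x) = e + <x, x>], and with
    [p(v) = <x, v> / rho(x)], half the differential of [log rho], the metric is
      [(4 / c) (<v, w> / rho - p(v) p(w) - p(Jv) p(Jw))]
    with Christoffel symbols
      [- (p(v) w + p(w) v - p(Jv) Jw - p(Jw) Jv)].
    All ambient facts (compatibility with the metric, parallelism of [J], the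
    curvature formula) are polynomial identities in these expressions. They are
    proved along an arbitrary map [F], which covers the identity map, hence the
    space form itself ([Gam_sfmetric]), and the hypersurface. The induced
    connection is then recognized by the uniqueness of the Levi-Civita
    connection ([levi_civita_unique], [Gam_indmet]). The analytic input is the
    symmetry of second derivatives ([derive_comm]). *)

Set Implicit Arguments.
Unset Strict Implicit.
Unset Printing Implicit Defensive.
Import Order.TTheory GRing.Theory Num.Theory.
Import numFieldNormedType.Exports.
Local Open Scope classical_set_scope.
Local Open Scope complex_scope.
Local Open Scope ring_scope.

(** * Directional derivatives of matrix-valued functions *)

Lemma is_derive_derivable (R : numFieldType) (V W : normedModType R)
    (f : V -> W) (u v : V) df : is_derive u v f df -> derivable f u v.
Proof. by case. Qed.

Lemma is_derive_value (R : numFieldType) (V W : normedModType R)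
    (f : V -> W) (u v : V) df : is_derive u v f df -> 'D_v f u = df.
Proof. by case. Qed.

Lemma is_derive_coord (R : realType) (V : normedModType R) (p q : nat)
    (A : V -> 'M[R]_(p, q)) (u v : V) dA i j :
  is_derive u v A dA -> is_derive u v (fun y => A y i j) (dA i j).
Proof.
move=> hA; have dA' := is_derive_derivable hA.
split; first exact: (derivable_mxP A u v).1 dA' i j.
by have := derive_mx dA'; rewrite (is_derive_value hA) => ->; rewrite mxE.
Qed.

Lemma is_derive_mx (R : realType) (V : normedModType R) (p q : nat)
    (A : V -> 'M[R]_(p, q)) (u v : V) (dA : 'M[R]_(p, q)) :
  (forall i j, is_derive u v (fun y => A y i j) (dA i j)) -> is_derive u v A dA.
Proof.
move=> hA; have dv : derivable A u v.
  by apply/derivable_mxP => i j; exact: (is_derive_derivable (hA i j)).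
split=> //; rewrite derive_mx //; apply/matrixP => i j; rewrite mxE.
exact: (is_derive_value (hA i j)).
Qed.

Lemma is_derive_mulmx (R : realType) (V : normedModType R) (p q r : nat)
    (A : V -> 'M[R]_(p, q)) (B : V -> 'M[R]_(q, r)) (u v : V) dA dB :
  is_derive u v A dA -> is_derive u v B dB ->
  is_derive u v (fun y => A y *m B y) (dA *m B u + A u *m dB).
Proof.
move=> hA hB; apply: is_derive_mx => i j.
have -> : (fun y => (A y *m B y) i j) =
    \sum_(l < q) ((fun y => A y i l) * (fun y => B y l j)).
  by apply/funext => y; rewrite mxE fct_sumE.
have -> : (dA *m B u + A u *m dB) i j =
    \sum_(l < q) (A u i l *: dB l j + B u l j *: dA i l).
  rewrite !mxE -big_split /=; apply: eq_bigr => l _.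
  by rewrite addrC; congr (_ + _); exact: mulrC.
apply: is_derive_sum => l.
exact: is_deriveM (is_derive_coord i l hA) (is_derive_coord l j hB).
Qed.

Lemma is_derive_mulmxr (R : realType) (V : normedModType R) (p q r : nat)
    (f : V -> 'M[R]_(p, q)) (B : 'M[R]_(q, r)) (u v : V) df :
  is_derive u v f df -> is_derive u v (fun y => f y *m B) (df *m B).
Proof.
move=> hf; apply: is_derive_eq (is_derive_mulmx hf (is_derive_cst B u v)) _.
by rewrite mulmx0 addr0.
Qed.

Lemma is_derive_trmx (R : realType) (V : normedModType R) (p q : nat)
    (f : V -> 'M[R]_(p, q)) (u v : V) df :
  is_derive u v f df -> is_derive u v (fun y => (f y)^T) df^T.
Proof.
move=> hf; apply: is_derive_mx => i j; rewrite mxE.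
rewrite (_ : (fun y => _) = (fun y => f y j i)); first exact: is_derive_coord.
by apply/funext => y; rewrite mxE.
Qed.

Lemma is_derive_scale (R : realType) (V : normedModType R) (q : nat)
    (s : V -> R) (f : V -> 'rV[R]_q) (u v : V) ds df :
  is_derive u v s ds -> is_derive u v f df ->
  is_derive u v (fun y => s y *: f y) (ds *: f u + s u *: df).
Proof.
move=> hs hf; apply: is_derive_mx => i j.
rewrite (_ : (fun y => _) = s * (fun y => f y i j)); last first.
  by apply/funext => y; rewrite mxE.
apply: is_derive_eq (is_deriveM hs (is_derive_coord i j hf)) _.
rewrite !mxE /GRing.scale /=; ring.
Qed.

Lemma is_derive_ip (R : realType) (V : normedModType R) (q : nat)
    (G : 'M[R]_q) (f g : V -> 'rV[R]_q) (u v : V) df dg :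
  is_derive u v f df -> is_derive u v g dg ->
  is_derive u v (fun y => ip G (f y) (g y)) (ip G df (g u) + ip G (f u) dg).
Proof.
move=> hf hg.
apply: is_derive_eq (is_derive_coord 0 0
  (is_derive_mulmx (is_derive_mulmxr G hf) (is_derive_trmx hg))) _.
by rewrite [LHS]mxE.
Qed.

Lemma is_derive_inv (R : realType) (V : normedModType R) (s : V -> R) (u v : V) ds :
  s u != 0 -> is_derive u v s ds ->
  is_derive u v (fun y => (s y)^-1) (- ds / s u ^+ 2).
Proof.
move=> s0 hs; have d := is_derive_derivable hs.
split; first exact: derivableV.
rewrite (deriveV s0 d) (is_derive_value hs).
by rewrite /GRing.scale /= mulNr mulNr mulrC.
Qed.

(** * Symmetry of second derivatives *)

Lemma nbhs_parallelogram (R : realType) (V : normedModType R) (x v w : V)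
    (P : set V) :
  nbhs x P -> exists2 d : R, 0 < d & forall s t : R, `|s| < d -> `|t| < d ->
    P (x + s *: v + t *: w).
Proof.
move=> /nbhs_ballP[e /= e0 he].
(* The summand 1 makes [M] positive even if [v] and [w] vanish. *)
pose M := `|v| + `|w| + 1.
have M0 : 0 < M by rewrite ltr_wpDl // addr_ge0.
exists (e / M); first by rewrite divr_gt0.
move=> s t hs ht; apply: he; rewrite -ball_normE /ball_ /=.
rewrite -addrA opprD addrA subrr add0r normrN.
apply: (le_lt_trans (ler_normD _ _)); rewrite !normrZ.
have hsv : `|s| * `|v| <= e / M * `|v| by rewrite ler_wpM2r // ltW.
have htw : `|t| * `|w| <= e / M * `|w| by rewrite ler_wpM2r // ltW.
apply: (le_lt_trans (lerD hsv htw)).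
rewrite -mulrDr -mulrA -[X in _ < X]mulr1 ltr_pM2l // mulrC ltr_pdivrMr //.
by rewrite mul1r /M ltrDl.
Qed.

Lemma is_derive_line (R : realType) (V : normedModType R) (f : V -> R)
  (y v : V) (s : R) : derivable f (y + s *: v) v ->
  is_derive s 1 (fun s => f (y + s *: v)) ('D_v f (y + s *: v)).
Proof.
move=> df.
have E : (fun h : R => h^-1 *: (((fun s => f (y + s *: v)) \o shift s) (h *: 1)
    - f (y + s *: v))) =
  (fun h : R => h^-1 *: ((f \o shift (y + s *: v)) (h *: v) - f (y + s *: v))).
  apply/funext => h /=; congr (_ *: (f _ - _)).
  by rewrite [h *: 1]mulr1 scalerDl addrCA.
by split; rewrite /derivable /derive E.
Qed.

(** The mean value theorem is applied to [s |-> f (x + s v + h w) - f (x + s v)]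
    and then to the resulting difference of first derivatives. *)
Lemma second_difference_MVT (R : realType) (V : normedModType R) (f : V -> R)
  (x v w : V) (h : R) : 0 < h ->
  (forall s t, 0 <= s <= h -> 0 <= t <= h ->
     derivable f (x + s *: v + t *: w) v /\
     derivable ('D_v f) (x + s *: v + t *: w) w) ->
  exists s t, [/\ 0 <= s <= h, 0 <= t <= h &
    f (x + h *: v + h *: w) - f (x + h *: v) - f (x + h *: w) + f x =
    h ^+ 2 * 'D_w ('D_v f) (x + s *: v + t *: w)].
Proof.
move=> h0 H.
have hh : 0 <= h <= h by rewrite ltW //=.
have oo_cc s : s \in `]0, h[ -> 0 <= s <= h.
  by rewrite in_itv /= => /andP[/ltW -> /ltW ->].
have h00 : 0 <= (0 : R) <= h by rewrite lexx ltW.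
pose g s := f ((x + h *: w) + s *: v) - f (x + s *: v).
have g' s : 0 <= s <= h -> is_derive s 1 g
    ('D_v f (x + s *: v + h *: w) - 'D_v f (x + s *: v)).
  move=> hs; apply: is_deriveB.
    have -> : x + s *: v + h *: w = x + h *: w + s *: v by rewrite addrAC.
    by apply: is_derive_line; rewrite addrAC; exact: (H s h hs hh).1.
  apply: is_derive_line.
  by have := (H s 0 hs h00).1; rewrite scale0r addr0; exact.
have gc : {within `[0, h], continuous g}.
  apply: derivable_within_continuous => s; rewrite in_itv /= => hs.
  exact: (is_derive_derivable (g' s hs)).
have [|s sin gs] := MVT h0 _ gc
  (df := fun s => 'D_v f (x + s *: v + h *: w) - 'D_v f (x + s *: v)).
  by move=> s /oo_cc; exact: g'.
have hs : 0 <= s <= h := oo_cc _ sin.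
pose k t := 'D_v f (x + s *: v + t *: w).
have k' t : 0 <= t <= h -> is_derive t 1 k ('D_w ('D_v f) (x + s *: v + t *: w)).
  by move=> ht; apply: is_derive_line; exact: (H s t hs ht).2.
have kc : {within `[0, h], continuous k}.
  apply: derivable_within_continuous => t; rewrite in_itv /= => ht.
  exact: (is_derive_derivable (k' t ht)).
have [|t tin kt] := MVT h0 _ kc (df := fun t => 'D_w ('D_v f) (x + s *: v + t *: w)).
  by move=> s' /oo_cc; exact: k'.
have ht : 0 <= t <= h := oo_cc _ tin.
exists s, t; split => //.
move: kt gs; rewrite /k /g !scale0r !addr0 !subr0 => -> E.
rewrite [x + h *: v + _]addrAC.
set q := _ *: _ in E *.
rewrite [LHS](_ : _ = 'D_w ('D_v f) (x + s *: v + t *: w) * h * h); last first.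
  by rewrite -E [in RHS]opprB [in RHS]addrA [in RHS]addrAC.
by rewrite -mulrA -expr2 mulrC.
Qed.

(** Schwarz: both mixed derivatives, taken at points near [x], equal the same
    second difference divided by [h ^+ 2]. *)
Lemma derive_comm (R : realType) (V : normedModType R) (f : V -> R) (x v w : V) :
  (\forall y \near x, derivable f y v /\ derivable f y w) ->
  (\forall y \near x, derivable ('D_v f) y w /\ derivable ('D_w f) y v) ->
  {for x, continuous ('D_w ('D_v f))} -> {for x, continuous ('D_v ('D_w f))} ->
  'D_w ('D_v f) x = 'D_v ('D_w f) x.
Proof.
move=> d1 d2 c1 c2.
apply/eqP; rewrite -subr_eq0 -normr_le0; apply/ler_addgt0Pl => e e0; rewrite addr0.
have e2 : 0 < e / 2 := divr_gt0 e0 (ltr0Sn R 1).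
have n1 := (cvgrPdist_lt _ _).1 c1 _ e2.
have n2 := (cvgrPdist_lt _ _).1 c2 _ e2.
have I := @filterI _ _ (nbhs_filter x).
have nA := I _ _ (I _ _ d1 d2) (I _ _ (n1 (nbhs_filter x)) (n2 (nbhs_filter x))).
have [d d0 hd] := nbhs_parallelogram v w nA.
have [d' d'0 hd'] := nbhs_parallelogram w v nA.
pose h := Num.min d d' / 2.
have h0 : 0 < h by rewrite divr_gt0 // lt_min d0.
have hd2 : h < d /\ h < d'.
  have : Num.min d d' <= d /\ Num.min d d' <= d' by rewrite !ge_min !lexx orbT.
  by have : 0 < Num.min d d' by [rewrite lt_min d0]; rewrite /h; lra.
have lt s : 0 <= s <= h -> `|s| < d /\ `|s| < d'.
  by move=> /andP[a b]; rewrite ger0_norm //; lra.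
have [|s [t [hs ht E]]] :=
    second_difference_MVT (f := f) (x := x) (v := v) (w := w) h0.
  move=> s t /lt[hs _] /lt[ht _].
  have [[dA dB] _] := hd s t hs ht; exact: conj dA.1 dB.1.
have [|s' [t' [hs' ht' E']]] :=
    second_difference_MVT (f := f) (x := x) (v := w) (w := v) h0.
  move=> s' t' /lt[_ hs'] /lt[_ ht'].
  have [[dA dB] _] := hd' s' t' hs' ht'; exact: conj dA.2 dB.2.
have EE : 'D_w ('D_v f) (x + s *: v + t *: w) =
    'D_v ('D_w f) (x + s' *: w + t' *: v).
  have h2 : h ^+ 2 != 0 := expf_neq0 2 (lt0r_neq0 h0).
  move: E' E; rewrite [x + h *: w + _]addrAC.
  move: ('D_w _ _) ('D_v _ _) (f _) (f _) (f _) (f _) (h ^+ 2) h2.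
  move=> A B f1 f2 f3 f4 k k0 E' E; apply: (mulfI k0); rewrite -E -E'.
  by congr (_ + f1); rewrite addrAC.
have [_ [q1 _]] := hd s t (lt s hs).1 (lt t ht).1.
have [_ [_ q2]] := hd' s' t' (lt s' hs').2 (lt t' ht').2.
rewrite /= EE in q1; rewrite /= distrC in q2.
move: q1 q2; move: ('D_w _ x) ('D_v _ x) ('D_v _ _) => a b c q1 q2.
rewrite [e]splitr -(subrKA c); apply: ltW.
apply: (le_lt_trans (ler_normD _ _)); exact: ltrD.
Qed.

(** * Smooth functions *)

(* From here on directional derivatives are compared by their arguments, never
   by unfolding them to limits. *)
#[local] Opaque derive.

(** The remainder of the first order expansion only depends on the germ, so the
    differential of [f] also serves for [g]. *)
Lemma differentiable_near_eq (R : realType) (V W : normedModType R)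
    (f g : V -> W) (x : V) :
  (\near x, f x = g x) -> differentiable f x -> differentiable g x.
Proof.
move=> fg df; have fgx : f x = g x := nbhs_singleton fg.
have [cf ef] := (diff_locallyP _ _).1 df.
have eg : g \o shift x = cst (g x) + 'd f x +o_ 0 id.
  apply/eqaddoP => e e0; have := (eqaddoP _ _ _ _).1 ef _ e0.
  have fg0 : \forall h \near 0, f (h + x) = g (h + x).
    by have := fg; rewrite (near_shift 0); apply: filterS => h /=; rewrite subr0.
  by apply: filterS2 fg0 => h /= fgh; rewrite !fctE /= fgh fgx.
have dg := diff_unique cf eg.
by apply/diff_locallyP; rewrite dg.
Qed.

Section SmoothClosure.
Variables (R : realType) (m : nat) (V : normedModType R) (U : set 'rV[R]_m).
Hypothesis openU : open U.
Implicit Types f g : 'rV[R]_m -> V.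

Lemma near_open (P : set 'rV[R]_m) x : U x -> (forall y, U y -> P y) ->
  \forall y \near x, P y.
Proof. by move=> Ux UP; apply: filterS UP _; exact: open_nbhs_nbhs. Qed.

(** Derivatives at a point only see values near it, and [U] is open. *)
Lemma Ck_ext k f g : (forall x, U x -> f x = g x) -> Ck k U f -> Ck k U g.
Proof.
elim: k f g => [|k IH] f g fg /=.
  move=> cf x Ux; rewrite /prop_for /continuous_at -(fg x Ux).
  apply: cvg_trans (cf x Ux).
  have gf : \forall y \near x, f y = g y := near_open Ux fg.
  exact: near_eq_cvg gf.
move=> [df Df]; split=> [x Ux|i].
  by apply: differentiable_near_eq (df x Ux); exact: (near_open Ux).
apply: IH (Df i) => x Ux; apply: near_eq_derive; exact: (near_open Ux).
Qed.

Lemma CkD k f g : Ck k U f -> Ck k U g -> Ck k U (f + g).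
Proof.
elim: k f g => [|k IH] f g /=.
  by move=> cf cg x Ux; apply: continuousD; [exact: cf | exact: cg].
move=> [df Df] [dg Dg]; split=> [x Ux|i].
  by apply: differentiableD; [exact: df | exact: dg].
apply: Ck_ext (IH _ _ (Df i) (Dg i)) => x Ux.
by rewrite deriveD //; apply: diff_derivable; [exact: df | exact: dg].
Qed.

Lemma CkZ k (a : R) f : Ck k U f -> Ck k U (a \*: f).
Proof.
elim: k f => [|k IH] f /=.
  by move=> cf x Ux; apply: continuousZl_tmp; exact: cf.
move=> [df Df]; split=> [x Ux|i].
  by apply: differentiableZ; exact: df.
apply: Ck_ext (IH _ (Df i)) => x Ux.
by rewrite deriveZ //; apply: diff_derivable; exact: df.
Qed.

Lemma Ck0 k : Ck k U (0 : 'rV[R]_m -> V).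
Proof.
elim: k => [|k IH] /=; first by move=> x _; exact: cst_continuous.
split=> [x _|i]; first exact: differentiable_cst.
apply: Ck_ext IH => x Ux; exact/esym/derive_cst.
Qed.

(** [Ck] speaks of partial derivatives only; any directional derivative is a
    linear combination of them with constant coefficients. *)
Lemma Ck_derive k f (v : 'rV[R]_m) : Ck k.+1 U f -> Ck k U ('D_v f).
Proof.
move=> [df Df].
apply: (@Ck_ext _ (\sum_i (v 0 i \*: 'D_(delta_mx 0 i) f))).
  move=> x Ux; rewrite deriveE; last exact: df.
  rewrite [in RHS](row_sum_delta v) linear_sum fct_sumE; apply: eq_bigr => i _ /=.
  by rewrite linearZ deriveE //; exact: df.
elim/big_ind: _ => [|a b|i _]; [exact: Ck0|exact: CkD|exact: CkZ (Df i)].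
Qed.

Lemma smooth_derive f (v : 'rV[R]_m) : smooth_on U f -> smooth_on U ('D_v f).
Proof. by move=> sf k; exact: Ck_derive. Qed.

End SmoothClosure.

Lemma smooth_subset (R : realType) (m : nat) (V : normedModType R)
    (U U' : set 'rV[R]_m) (f : 'rV[R]_m -> V) :
  U' `<=` U -> smooth_on U f -> smooth_on U' f.
Proof.
move=> UU' sf k; elim: k f sf => [|k IH] f sf /=.
  by move=> x /UU'; exact: (sf 0%N).
split=> [x /UU' | i]; first exact: (sf 1%N).1.
by apply: IH => k'; exact: (sf k'.+1).2.
Qed.

Lemma smooth_continuous (R : realType) (m : nat) (V : normedModType R)
    (U : set 'rV[R]_m) (f : 'rV[R]_m -> V) x :
  smooth_on U f -> U x -> {for x, continuous f}.
Proof. by move=> sf; exact: (sf 0%N). Qed.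

Lemma smooth_differentiable (R : realType) (m : nat) (V : normedModType R)
    (U : set 'rV[R]_m) (f : 'rV[R]_m -> V) x :
  smooth_on U f -> U x -> differentiable f x.
Proof. by move=> sf; exact: (sf 1%N).1. Qed.

Lemma smooth_is_derive (R : realType) (m : nat) (V : normedModType R)
    (U : set 'rV[R]_m) (f : 'rV[R]_m -> V) x v :
  smooth_on U f -> U x -> is_derive x v f ('D_v f x).
Proof.
by move=> sf Ux; apply/derivableP/diff_derivable; exact: smooth_differentiable Ux.
Qed.

(** [derive_comm] is about real-valued functions, hence is applied to each
    coordinate. *)
Lemma smooth_derive_comm (R : realType) (m n : nat) (U : set 'rV[R]_m)
    (f : 'rV[R]_m -> 'rV[R]_n) x v w :
  open U -> smooth_on U f -> U x -> 'D_w ('D_v f) x = 'D_v ('D_w f) x.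
Proof.
move=> oU sf Ux; have sD v' := smooth_derive oU v' sf.
have sDD v' w' := smooth_derive oU w' (sD v').
have coord (g : 'rV[R]_m -> 'rV[R]_n) (v' y : 'rV[R]_m) j : smooth_on U g -> U y ->
    is_derive y v' (fun z => g z 0 j) ('D_v' g y 0 j).
  by move=> sg Uy; apply: is_derive_coord; exact: smooth_is_derive sg Uy.
have coordE (g : 'rV[R]_m -> 'rV[R]_n) (v' y : 'rV[R]_m) j : smooth_on U g -> U y ->
    'D_v' (fun z => g z 0 j) y = 'D_v' g y 0 j.
  by move=> sg Uy; exact: (is_derive_value (coord g v' y j sg Uy)).
have E2 v' w' y j : U y ->
    'D_w' ('D_v' (fun z => f z 0 j)) y = 'D_w' ('D_v' f) y 0 j.
  move=> Uy; rewrite -(coordE _ _ _ _ (sD v') Uy).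
  by apply: near_eq_derive; apply: (near_open oU Uy) => z Uz; exact: coordE.
have c2 v' w' j : {for x, continuous ('D_w' ('D_v' (fun z => f z 0 j)))}.
  have c : {for x, continuous (fun y => 'D_w' ('D_v' f) y 0 j)}.
    apply: (@continuous_comp _ _ _ ('D_w' ('D_v' f)) (fun M : 'rV[R]_n => M 0 j)).
      exact: smooth_continuous (sDD v' w') Ux.
    exact: coord_continuous.
  rewrite /prop_for /continuous_at (E2 v' w' x j Ux); apply: cvg_trans c.
  have gf : \forall y \near x,
      'D_w' ('D_v' f) y 0 j = 'D_w' ('D_v' (fun z => f z 0 j)) y.
    by apply: (near_open oU Ux) => y Uy; exact/esym/E2.
  exact: near_eq_cvg gf.
have d2 v' w' y j : U y -> derivable ('D_v' (fun z => f z 0 j)) y w'.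
  move=> Uy; have := is_derive_derivable (coord _ w' y j (sD v') Uy).
  apply: near_eq_derivable; apply: (near_open oU Uy) => z Uz; exact/esym/coordE.
apply/rowP => j; apply: etrans (esym (E2 v w x j Ux)) (etrans _ (E2 w v x j Ux)).
apply: derive_comm; last exact: c2; last exact: c2.
  apply: (near_open oU Ux) => y Uy.
  by split; exact: (is_derive_derivable (coord _ _ y j sf Uy)).
by apply: (near_open oU Ux) => y Uy; split; exact: d2.
Qed.

Lemma derivable_prod (R : realType) (V : normedModType R) (I : finType)
    (f : I -> V -> R) (u v : V) :
  (forall i, derivable (f i) u v) -> derivable (fun y => \prod_i f i y) u v.
Proof.
move=> df; rewrite (_ : (fun y => _) = \prod_i f i); last first.
  by apply/funext => y; rewrite fct_prodE.
apply: (big_ind (fun g => derivable g u v)) => [|g h|i _]; last exact: df.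
  exact: derivable_cst.
exact: derivableM.
Qed.

Lemma derivable_fsum (R : realType) (V : normedModType R) (I : finType)
    (f : I -> V -> R) (u v : V) :
  (forall i, derivable (f i) u v) -> derivable (fun y => \sum_i f i y) u v.
Proof.
move=> df; rewrite (_ : (fun y => _) = \sum_i f i); last first.
  by apply/funext => y; rewrite fct_sumE.
apply: (big_ind (fun g => derivable g u v)) => [|g h|i _]; last exact: df.
  exact: derivable_cst.
exact: derivableD.
Qed.

Lemma derivable_det (R : realType) (V : normedModType R) (p : nat)
    (A : V -> 'M[R]_p) (u v : V) :
  (forall i j, derivable (fun y => A y i j) u v) ->
  derivable (fun y => \det (A y)) u v.
Proof.
move=> dA; apply: derivable_fsum => s; apply: derivableM.
  exact: derivable_cst.
by apply: derivable_prod => i; exact: dA.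
Qed.

(** Cramer's rule: near [u] the inverse is the adjugate divided by the
    determinant, both polynomial in the entries. *)
Lemma derivable_invmx (R : realType) (V : normedModType R) (p : nat)
    (A : V -> 'M[R]_p) (u v : V) :
  (\forall y \near u, A y \in unitmx) -> derivable A u v ->
  derivable (fun y => invmx (A y)) u v.
Proof.
move=> uA /derivable_mxP dA.
have d0 : \det (A u) != 0.
  by rewrite -unitfE -[_ \is a _]unitmxE; exact: nbhs_singleton uA.
have dd : derivable (fun y => \det (A y)) u v := derivable_det dA.
have ddV := @derivableV R V (fun y => \det (A y)) u v d0 dd.
have : derivable (fun y => (\det (A y))^-1 *: \adj (A y)) u v.
  apply/derivable_mxP => i j.
  rewrite (_ : (fun y => _) =
    (fun y => (\det (A y))^-1) * (fun y => \adj (A y) i j)); last first.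
    by apply/funext => y; rewrite mxE.
  apply: derivableM; first exact: ddV.
  rewrite (_ : (fun y => _) =
    cst ((-1) ^+ (j + i)) * (fun y => \det (row' j (col' i (A y))))); last first.
    by apply/funext => y; rewrite mxE.
  apply: derivableM; first exact: derivable_cst.
  apply: derivable_det => a b.
  rewrite (_ : (fun y => _) = (fun y => A y (lift j a) (lift i b))); last first.
    by apply/funext => y; rewrite !mxE.
  exact: dA.
apply: near_eq_derivable; apply: filterS uA => y uAy.
by rewrite /invmx uAy.
Qed.

(** * Bilinear forms on row vectors *)

Section IpLinear.
Variables (R : realType) (m : nat) (G : 'M[R]_m).
Implicit Types v w : 'rV[R]_m.
Lemma ipDl v1 v2 w : ip G (v1 + v2) w = ip G v1 w + ip G v2 w.
Proof. by rewrite /ip !mulmxDl mxE. Qed.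
Lemma ipDr v w1 w2 : ip G v (w1 + w2) = ip G v w1 + ip G v w2.
Proof. by rewrite /ip linearD mulmxDr mxE. Qed.
Lemma ipZl a v w : ip G (a *: v) w = a * ip G v w.
Proof. by rewrite /ip -!scalemxAl mxE. Qed.
Lemma ipZr a v w : ip G v (a *: w) = a * ip G v w.
Proof. by rewrite /ip linearZ -!scalemxAr mxE. Qed.
Lemma ipNl v w : ip G (- v) w = - ip G v w.
Proof. by rewrite -scaleN1r ipZl mulN1r. Qed.
Lemma ipNr v w : ip G v (- w) = - ip G v w.
Proof. by rewrite -scaleN1r ipZr mulN1r. Qed.
Lemma ip0l w : ip G 0 w = 0.
Proof. by rewrite -(scale0r 0) ipZl mul0r. Qed.
Lemma ip0r w : ip G w 0 = 0.
Proof. by rewrite -(scale0r 0) ipZr mul0r. Qed.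
Lemma ip_sym v w : G^T = G -> ip G v w = ip G w v.
Proof.
move=> gs; rewrite /ip; have <- : (w *m G *m v^T)^T = v *m G *m w^T.
  by rewrite !trmx_mul trmxK gs mulmxA.
by rewrite mxE.
Qed.
Lemma ip_delta v j : ip G v (delta_mx 0 j) = (v *m G) 0 j.
Proof. by rewrite /ip trmx_delta -colE mxE. Qed.
Lemma ip_nondeg v : G \in unitmx -> (forall w, ip G v w = 0) -> v = 0.
Proof.
move=> Gu h; rewrite -[v](mulmxK Gu).
suff -> : v *m G = 0 by rewrite mul0mx.
apply/rowP => j; rewrite [RHS]mxE -(h (delta_mx 0 j)).
by rewrite ip_delta.
Qed.
End IpLinear.

Lemma nondeg_unit (R : realType) (m : nat) (G : 'M[R]_m) :
  (forall v, (forall w, ip G v w = 0) -> v = 0) -> G \in unitmx.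
Proof.
move=> h; rewrite -row_free_unit; apply: inj_row_free => v vG.
by apply: h => w; rewrite /ip vG mul0mx mxE.
Qed.

Section LinearMorph.
Variables (R : pzRingType) (V W : lmodType R) (f : V -> W).
Hypothesis lf : linear f.

Lemma linear_morphD v w : f (v + w) = f v + f w.
Proof. by rewrite -[v]scale1r lf !scale1r. Qed.

Lemma linear_morph0 : f 0 = 0.
Proof. by have := lf (-1) 0 0; rewrite scaleN1r oppr0 addr0 scaleN1r addNr. Qed.

Lemma linear_morphZ a v : f (a *: v) = a *: f v.
Proof. by rewrite -[a *: v]addr0 lf linear_morph0 addr0. Qed.

End LinearMorph.

Lemma linear_row (R : realType) (m : nat) (W : lmodType R) (f : 'rV[R]_m -> W) v :
  linear f -> f v = \sum_i v 0 i *: f (delta_mx 0 i).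
Proof.
move=> lf; pose fM := GRing.isLinear.Build _ _ _ _ f lf.
pose fL : {linear 'rV[R]_m -> W} := HB.pack f fM.
rewrite -[f]/(fL : _ -> _) [in LHS](row_sum_delta v) linear_sum.
by apply: eq_bigr => i _; rewrite linearZ.
Qed.

Lemma bilinear_row (R : realType) (m : nat) (W : lmodType R)
    (T : 'rV[R]_m -> 'rV[R]_m -> W) v w :
  (forall w, linear (T^~ w)) -> (forall v, linear (T v)) ->
  T v w = \sum_i \sum_j (v 0 i * w 0 j) *: T (delta_mx 0 i) (delta_mx 0 j).
Proof.
move=> l1 l2; rewrite (linear_row v (l1 w)); apply: eq_bigr => i _.
rewrite (linear_row w (l2 _)) scaler_sumr; apply: eq_bigr => j _.
by rewrite scalerA.
Qed.

(** * Uniqueness of the Levi-Civita connection *)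

(** Koszul: for a symmetric [T] compatible with [g], the combination of first
    derivatives in the Christoffel symbol of [i] and [j] with lower index [s] is
    twice [g (T e_i e_j) e_s]. The lemma identifies both the ambient and the
    induced connection without ever computing an inverse metric. *)
Lemma levi_civita_unique (R : realType) (m : nat) (g : 'rV[R]_m -> 'M[R]_m)
    (x : 'rV[R]_m) (T : 'rV[R]_m -> 'rV[R]_m -> 'rV[R]_m) :
  g x \in unitmx -> (g x)^T = g x ->
  (forall w, linear (T^~ w)) -> (forall v, linear (T v)) ->
  (forall v w, T v w = T w v) ->
  (forall k i j, pd k (fun y => g y i j) x =
     ip (g x) (T (delta_mx 0 k) (delta_mx 0 i)) (delta_mx 0 j) +
     ip (g x) (delta_mx 0 i) (T (delta_mx 0 k) (delta_mx 0 j))) ->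
  forall v w, Gam g x v w = T v w.
Proof.
move=> gu gs l1 l2 Ts compat v w.
have ips (z y : 'rV[R]_m) : ip (g x) z y = ip (g x) y z by exact: ip_sym.
have chr l i j : christoffel g x l i j = T (delta_mx 0 i) (delta_mx 0 j) 0 l.
  rewrite /christoffel.
  have -> : \sum_s invmx (g x) l s *
    (pd i (fun y => g y j s) x + pd j (fun y => g y i s) x
       - pd s (fun y => g y i j) x) =
    2 * \sum_s (T (delta_mx 0 i) (delta_mx 0 j) *m g x) 0 s * invmx (g x) s l.
    rewrite mulr_sumr; apply: eq_bigr => s _.
    have -> : invmx (g x) s l = invmx (g x) l s.
      by rewrite -[in RHS]gs -trmx_inv mxE.
    rewrite !compat -ip_delta.
    rewrite ![ip _ (delta_mx 0 _) (T _ _)]ips.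
    rewrite (Ts (delta_mx 0 j) (delta_mx 0 i)).
    rewrite (Ts (delta_mx 0 s) (delta_mx 0 i)) (Ts (delta_mx 0 s) (delta_mx 0 j)).
    by move: (ip _ _ _) (ip _ _ _) (ip _ _ _) => a b d; ring.
  rewrite mulrA mulVf ?pnatr_eq0 // mul1r.
  by rewrite -{2}(mulmxK gu (T _ _)) [in RHS]mxE.
rewrite /Gam (bilinear_row v w l1 l2).
apply/rowP => l; rewrite mxE summxE; apply: eq_bigr => i _.
rewrite summxE; apply: eq_bigr => j _.
by rewrite chr mxE [RHS]mulrC mulrA.
Qed.

(** * Pointwise algebra of the nullity condition *)

Section NullityAlgebra.
Variables (R : realType) (m : nat) (g : 'M[R]_m).
Variables (A ph : 'rV[R]_m -> 'rV[R]_m) (xi : 'rV[R]_m) (q ka mu nu : R).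
Local Notation eta v := (ip g v xi).
Hypotheses (gu : g \in unitmx) (gs : g^T = g).
Hypotheses (lA : linear A) (Asa : forall v w, ip g (A v) w = ip g v (A w)).
Hypotheses (lph : linear ph) (phskew : forall v w, ip g (ph v) w = - ip g v (ph w)).
Hypotheses (eta1 : eta xi = 1) (phxi : ph xi = 0).
Hypothesis phph : forall v, ph (ph v) = - v + eta v *: xi.
Hypothesis nul : forall v w,
  q *: (eta w *: v - eta v *: w) + eta (A w) *: A v - eta (A v) *: A w =
  ka *: (eta w *: v - eta v *: w) + mu *: (eta w *: A v - eta v *: A w)
  + nu *: (eta w *: ph (A v) - eta v *: ph (A w)).
Hypothesis nu0 : nu != 0.

Lemma g_sym v w : ip g v w = ip g w v. Proof. exact: ip_sym. Qed.

Lemma eta_ph v : eta (ph v) = 0.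
Proof. by rewrite phskew phxi ip0r oppr0. Qed.

Lemma phph0 v : eta v = 0 -> ph (ph v) = - v.
Proof. by move=> v0; rewrite phph v0 scale0r addr0. Qed.

Let al := eta (A xi).
Let V := A xi - al *: xi.

Lemma nullity_horizontal v w : eta v = 0 -> eta w = 0 ->
  eta (A w) *: A v = eta (A v) *: A w.
Proof.
move=> v0 w0; have := nul v w.
rewrite v0 w0 !(scale0r, oppr0, addr0, scaler0, add0r).
by move/eqP; rewrite subr_eq0 => /eqP.
Qed.

Lemma nullity_at_xi v : eta v = 0 ->
  q *: v + al *: A v - eta (A v) *: A xi = ka *: v + mu *: A v + nu *: ph (A v).
Proof. by move=> v0; have := nul v xi; rewrite v0 eta1 !scale0r !subr0 !scale1r. Qed.

Lemma eta_shape v : eta v = 0 -> eta (A v) = ip g v V.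
Proof. by move=> v0; rewrite Asa /V ipDr ipNr ipZr v0 mulr0 subr0. Qed.

Lemma eta_V : eta V = 0.
Proof. by rewrite /V ipDl ipNl ipZl eta1 mulr1 subrr. Qed.

Let hor v := v - eta v *: xi.
Lemma eta_hor v : eta (hor v) = 0.
Proof. by rewrite /hor ipDl ipNl ipZl eta1 mulr1 subrr. Qed.
Lemma hor_split v : v = hor v + eta v *: xi.
Proof. by rewrite /hor subrK. Qed.

(** The kernel of [eta] is the orthogonal complement of the nonisotropic
    vector [xi], so [g] is nondegenerate on it. *)
Lemma horizontal_nondeg v : eta v = 0 -> v != 0 -> exists2 w, eta w = 0 & ip g v w != 0.
Proof.
move=> v0 vn; apply: contrapT => h; case/negP: vn; apply/eqP.
apply: (ip_nondeg gu) => w; rewrite (hor_split w) ipDr ipZr v0 mulr0 addr0.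
apply/eqP/negPn/negP => hw; apply: h; exists (hor w) => //; exact: eta_hor.
Qed.

(** With [w] the image of [v] by a complex structure, this is the
    injectivity of complex scalars [a - i b] acting on a nonzero vector. *)
Lemma rotation_eq0 (a b : R) (v w : 'rV[R]_m) :
  a *: v = b *: w -> a *: w = - (b *: v) -> v != 0 -> a = 0 /\ b = 0.
Proof.
move=> h1 h2 v0.
have : (a ^+ 2 + b ^+ 2) *: v = 0.
  rewrite scalerDl expr2 -scalerA h1 scalerA mulrC -scalerA h2.
  by rewrite scalerN scalerA expr2 addNr.
move/eqP; rewrite scaler_eq0 (negPf v0) orbF.
by rewrite paddr_eq0 ?sqr_ge0 // !sqrf_eq0 => /andP[/eqP -> /eqP ->].
Qed.

(** Suppose [V <> 0] and pick [Y] horizontal with [t = g Y V <> 0]. By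
    [nullity_horizontal], on [ker eta] the map [A] is the rank one map
    [X |-> (g X V / t) A Y], and [A Y = t xi + ga V] by symmetry of [A].
    The condition at [xi] applied to [ph V], which [A] kills, gives [ka = q]; the
    [xi] component of the condition at [xi] applied to [Y] gives [mu = 0]. What
    remains is
    [(al ga - t) V = nu ga (ph V)], whence [ga = 0] and [t = 0]. *)
Lemma hopf_of_nullity : V = 0.
Proof.
apply/eqP/negPn/negP => V0.
have [Y Y0 VY] := horizontal_nondeg eta_V V0.
set t := eta (A Y); have tE : t = ip g Y V by rewrite /t eta_shape.
have t0 : t != 0 by rewrite tE g_sym.
have phV0 : eta (ph V) = 0 := eta_ph V.
have aphV : eta (A (ph V)) = 0.
  rewrite eta_shape // ; have /eqP : ip g (ph V) V = - ip g (ph V) V.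
    by rewrite {1}phskew g_sym.
  by rewrite -addr_eq0 -mulr2n mulrn_eq0 /= => /eqP.
have AphV : A (ph V) = 0.
  have := nullity_horizontal phV0 Y0; rewrite aphV scale0r => /eqP.
  by rewrite scaler_eq0 -/t (negPf t0) /= => /eqP.
have phVn : ph V != 0.
  apply/eqP => pV; case/negP: V0.
  rewrite -oppr_eq0 -(phph0 eta_V) pV (linear_morph0 lph).
  exact: eqxx.
have kaq : q = ka.
  have := nullity_at_xi phV0.
  rewrite AphV (linear_morph0 lph) ip0l !scaler0 scale0r !addr0 subr0 => /eqP.
  by rewrite -subr_eq0 -scalerBl scaler_eq0 (negPf phVn) orbF subr_eq0 => /eqP.
set T := A Y in t tE t0 *.
have eqY : al *: T - t *: A xi = mu *: T + nu *: ph T.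
  have := nullity_at_xi Y0; rewrite -kaq -!addrA => /addrI; exact.
have mu0 : mu = 0.
  have := congr1 (fun z => ip g z xi) eqY.
  rewrite /= !ipDl ipNl !ipZl eta_ph mulr0 addr0 -/al -/t mulrC subrr.
  by move/esym/eqP; rewrite mulf_eq0 (negPf t0) orbF => /eqP.
pose ga := ip g T Y / t.
have TE : T = t *: xi + ga *: V.
  apply/eqP; rewrite -subr_eq0; apply/eqP; apply: (ip_nondeg gu) => x.
  have X0 := eta_hor x; set X := hor x in X0.
  have AX : A X = (eta (A X) / t) *: T.
    have := nullity_horizontal X0 Y0; rewrite -/T -/t => h.
    by rewrite mulrC -scalerA -h scalerA mulVf // scale1r.
  have TX : ip g T X = ga * ip g V X.
    rewrite g_sym /T -Asa AX ipZl (eta_shape X0) /ga (g_sym X V) (g_sym T Y).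
    by rewrite g_sym; ring.
  rewrite (hor_split x) -/X ipDr !ipZr !(ipDl, ipNl) opprD !(ipDl, ipNl, ipZl).
  by rewrite TX /V !(ipDl, ipNl, ipZl) -/al -/t eta1 (g_sym xi X) X0; ring.
have eqV : (al * ga - t) *: V = (nu * ga) *: ph V.
  move: eqY; rewrite mu0 scale0r add0r {2}TE (linear_morphD lph).
  rewrite !(linear_morphZ lph) phxi scaler0 add0r scalerA => <-.
  have -> : A xi = V + al *: xi by rewrite /V subrK.
  rewrite TE; apply/rowP => i; rewrite !mxE; ring.
have eqV2 : (al * ga - t) *: ph V = - ((nu * ga) *: V).
  by rewrite -(linear_morphZ lph) eqV (linear_morphZ lph) (phph0 eta_V) scalerN.
have [h1 h2] := rotation_eq0 eqV eqV2 V0.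
move/eqP: h2; rewrite mulf_eq0 (negPf nu0) /= => /eqP ga0.
by move: h1; rewrite ga0 mulr0 sub0r => /eqP; rewrite oppr_eq0 (negPf t0).
Qed.

(** On [ker eta] the condition says that [(ka - q) g + (mu - al) S] equals
    [nu S(., ph .)] for the symmetric form [S X Y = g (A X) Y]. The left side is
    symmetric, so [S(., ph .)] is symmetric; replacing [Y] by [ph Y] makes the
    term [(ka - q) g(., ph .)], which is skew, equal to symmetric terms, so
    [ka = q]. The two relations then give
    [((mu - al) ^+ 2 + nu ^+ 2) S = 0]. *)
Lemma shape_of_nullity : (exists2 X, X != 0 & eta X = 0) ->
  forall v, A v = (eta v * eta (A xi)) *: xi.
Proof.
case=> X0 X0n X0D.
have Axi : A xi = al *: xi.
  by apply/eqP; rewrite -subr_eq0; apply/eqP; exact: hopf_of_nullity.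
have eAD X : eta X = 0 -> eta (A X) = 0.
  by move=> X0'; rewrite Asa Axi ipZr X0' mulr0.
have E1 X Y : eta X = 0 -> eta Y = 0 ->
    (ka - q) * ip g X Y + (mu - al) * ip g (A X) Y = nu * ip g (A X) (ph Y).
  move=> hX hY; have := congr1 (fun z => ip g z Y) (nullity_at_xi hX).
  rewrite eAD // scale0r subr0 /= !ipDl !ipZl phskew => h.
  have -> : nu * ip g (A X) (ph Y) = - (nu * - ip g (A X) (ph Y)).
    by rewrite mulrN opprK.
  by move: h; move: (nu * _) => s h; lra.
have Ss X Y : ip g (A X) Y = ip g (A Y) X by rewrite Asa g_sym.
have Sph X Y : eta X = 0 -> eta Y = 0 -> ip g (A X) (ph Y) = ip g (A Y) (ph X).
  move=> hX hY; apply: (mulfI nu0); rewrite -!E1 //.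
  by rewrite (g_sym X Y) (Ss X Y).
have E2 X Y : eta X = 0 -> eta Y = 0 ->
    (ka - q) * ip g X (ph Y) + (mu - al) * ip g (A X) (ph Y) = - (nu * ip g (A X) Y).
  by move=> hX hY; rewrite E1 ?eta_ph // phph0 // ipNr mulrN.
have a0 : ka - q = 0.
  have [Y hY XY] := horizontal_nondeg X0D X0n.
  have h1 := E2 X0 (ph Y) X0D (eta_ph Y).
  have h2 := E2 (ph Y) X0 (eta_ph Y) X0D.
  (* The relation [E2] for the pair [X0], [ph Y] and for the swapped pair: the
     sides agree except for the sign of the term in [ka - q]. *)
  have e1 : ip g (ph Y) (ph X0) = - ip g X0 (ph (ph Y)).
    by rewrite phskew phph0 // phph0 // !ipNr g_sym.
  rewrite e1 (Ss (ph Y) X0) (Sph (ph Y) X0 (eta_ph Y) X0D) in h2.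
  rewrite phph0 // ipNr in h1 h2.
  have : (ka - q) * ip g X0 Y = 0 by move: h1 h2; move: (nu * _) => s; lra.
  by move/eqP; rewrite mulf_eq0 (negPf XY) orbF => /eqP.
have S0 X Y : eta X = 0 -> eta Y = 0 -> ip g (A X) Y = 0.
  move=> hX hY; have := E1 X Y hX hY; have := E2 X Y hX hY.
  rewrite a0 !mul0r !add0r; move: (mu - al) (ip g _ Y) (ip g _ (ph Y)) => b s p h2 h1.
  have : (b ^+ 2 + nu ^+ 2) * s = 0.
    have -> : (b ^+ 2 + nu ^+ 2) * s = b * (b * s) - nu * (- (nu * s)) by ring.
    by rewrite h1 -h2; ring.
  move/eqP; rewrite mulf_eq0 => /orP[|/eqP //].
  by rewrite paddr_eq0 ?sqr_ge0 // !sqrf_eq0 (negPf nu0) andbF.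
have AD0 X : eta X = 0 -> A X = 0.
  move=> hX; apply: (ip_nondeg gu) => y.
  by rewrite (hor_split y) ipDr ipZr eAD // mulr0 addr0 S0 // eta_hor.
move=> v; rewrite {1}(hor_split v) (linear_morphD lA) (linear_morphZ lA).
by rewrite AD0 ?eta_hor // add0r Axi scalerA ipZl eta1 mulr1.
Qed.

End NullityAlgebra.

(** * The space form in real affine coordinates *)

Section Model.
Variables (R : realType) (n : nat).
Local Notation k := (n + n)%N.
Variables (J E : 'M[R]_k) (e c : R).
Hypotheses (JJ : J *m J = - 1%:M) (Es : E^T = E) (JE : J *m E *m J^T = E).
Hypotheses (Eu : E \in unitmx) (e0 : e != 0) (c0 : c != 0).
Implicit Types (x z : 'rV[R]_k).

Definition rho x : R := e + ip E x x.
Definition nform x v w : R := ip E v w / rho x.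
(** The value on [v] of half the differential of [log rho] at [x]. *)
Definition hdlog x v : R := nform x x v.
(** The matrix of the metric whose values are given by [ip_sfmetric]. *)
Definition sfmetric x : 'M[R]_k :=
  (4 / c) *: ((rho x)^-1 *: E
    - ((rho x)^-1 *: (x *m E))^T *m ((rho x)^-1 *: (x *m E))
    - ((rho x)^-1 *: (x *m E *m J^T))^T *m ((rho x)^-1 *: (x *m E *m J^T))).
Definition sfconn x v w : 'rV[R]_k :=
  - (hdlog x v *: w + hdlog x w *: v
     - hdlog x (v *m J) *: (w *m J) - hdlog x (w *m J) *: (v *m J)).

Lemma mulJJ (v : 'rV[R]_k) : v *m J *m J = - v.
Proof. by rewrite -mulmxA JJ mulmxN mulmx1. Qed.

Lemma ipJJ v w : ip E (v *m J) (w *m J) = ip E v w.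
Proof. by rewrite /ip trmx_mul -!mulmxA (mulmxA E) (mulmxA J) (mulmxA J) JE. Qed.

Lemma ipJl v w : ip E (v *m J) w = - ip E v (w *m J).
Proof. by rewrite -(ipJJ v) mulJJ ipNr opprK. Qed.

Lemma ipE_sym v w : ip E v w = ip E w v. Proof. exact: ip_sym. Qed.

Lemma ipxJx v : ip E v (v *m J) = 0.
Proof.
have /eqP : ip E v (v *m J) = - ip E v (v *m J) by rewrite -ipJl ipE_sym.
by rewrite -addr_eq0 -mulr2n mulrn_eq0 /= => /eqP.
Qed.

Lemma nformDl x v1 v2 w : nform x (v1 + v2) w = nform x v1 w + nform x v2 w.
Proof. by rewrite /nform ipDl mulrDl. Qed.
Lemma nformDr x v w1 w2 : nform x v (w1 + w2) = nform x v w1 + nform x v w2.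
Proof. by rewrite /nform ipDr mulrDl. Qed.
Lemma nformZl x a v w : nform x (a *: v) w = a * nform x v w.
Proof. by rewrite /nform ipZl mulrA. Qed.
Lemma nformZr x a v w : nform x v (a *: w) = a * nform x v w.
Proof. by rewrite /nform ipZr mulrA. Qed.
Lemma nformNl x v w : nform x (- v) w = - nform x v w.
Proof. by rewrite -scaleN1r nformZl mulN1r. Qed.
Lemma nformNr x v w : nform x v (- w) = - nform x v w.
Proof. by rewrite -scaleN1r nformZr mulN1r. Qed.
Lemma nform_sym x v w : nform x v w = nform x w v.
Proof. by rewrite /nform ipE_sym. Qed.
Lemma nformJl x v w : nform x (v *m J) w = - nform x v (w *m J).
Proof. by rewrite /nform ipJl mulNr. Qed.
Lemma hdlogD x v w : hdlog x (v + w) = hdlog x v + hdlog x w.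
Proof. exact: nformDr. Qed.
Lemma hdlogZ x a v : hdlog x (a *: v) = a * hdlog x v.
Proof. exact: nformZr. Qed.
Lemma hdlogN x v : hdlog x (- v) = - hdlog x v.
Proof. exact: nformNr. Qed.
Lemma hdlogxJ x : hdlog x (x *m J) = 0.
Proof. by rewrite /hdlog /nform ipxJx mul0r. Qed.
Definition hdlogE := (hdlogD, hdlogZ, hdlogN).
Definition nformE := (nformDl, nformDr, nformZl, nformZr, nformNl, nformNr).

Lemma ip_sfmetric x v w :
  ip (sfmetric x) v w =
  4 / c * (nform x v w - hdlog x v * hdlog x w
           - hdlog x (v *m J) * hdlog x (w *m J)).
Proof.
have rank1 (a : 'rV[R]_k) : ip (a^T *m a) v w = (a *m v^T) 0 0 * (a *m w^T) 0 0.
  rewrite /ip mulmxA -mulmxA.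
  have -> : v *m a^T = (a *m v^T)^T by rewrite trmx_mul trmxK.
  by rewrite {1}(mx11_scalar (a *m v^T)) tr_scalar_mx mul_scalar_mx mxE.
have ipS (a : R) (G : 'M[R]_k) : ip (a *: G) v w = a * ip G v w.
  by rewrite /ip -scalemxAr -scalemxAl mxE.
have ipB (G G' : 'M[R]_k) : ip (G - G') v w = ip G v w - ip G' v w.
  by rewrite /ip mulmxBr mulmxBl !mxE.
(* The two vectors in [sfmetric] represent the forms [p] and [p o J]. *)
have P1 z : ((rho x)^-1 *: (x *m E) *m z^T) 0 0 = hdlog x z.
  by rewrite /hdlog /nform /ip -scalemxAl mxE mulrC.
have P2 z : ((rho x)^-1 *: (x *m E *m J^T) *m z^T) 0 0 = hdlog x (z *m J).
  by rewrite /hdlog /nform /ip -scalemxAl mxE mulrC trmx_mul mulmxA.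
rewrite /sfmetric ipS !ipB ipS !rank1 !P1 !P2 {1}/nform.
by rewrite [in LHS]mulrC [_ / rho x]mulrC mulrC.
Qed.

Lemma sfmetric_sym x : (sfmetric x)^T = sfmetric x.
Proof.
rewrite /sfmetric; set P := _ *: (x *m E); set Q := _ *: (x *m E *m _).
have trB (A B : 'M[R]_k) : (A - B)^T = A^T - B^T.
  by apply/matrixP => i j; rewrite !mxE.
have trZ a (A : 'M[R]_k) : (a *: A)^T = a *: A^T.
  by apply/matrixP => i j; rewrite !mxE.
by rewrite trZ !trB trZ Es !trmx_mul !trmxK.
Qed.

Lemma sfmetricJ x v w :
  ip (sfmetric x) (v *m J) (w *m J) = ip (sfmetric x) v w.
Proof.
rewrite !ip_sfmetric !mulJJ !hdlogN {1}/nform ipJJ -/(nform x v w).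
by congr (_ * _); ring.
Qed.

(** A vector [v] in the radical satisfies [v = p(v) x - p(Jv) J x]; applying [p]
    and [p o J] to this, with [p(x) = 1 - e / rho(x)] and [p(J x) = 0], gives
    [p(v) = p(Jv) = 0]. For [e = 0] the point [x] itself would be in the radical. *)
Lemma sfmetric_nondeg x v : rho x != 0 ->
  (forall w, ip (sfmetric x) v w = 0) -> v = 0.
Proof.
move=> r0 h.
have vE : v = hdlog x v *: x - hdlog x (v *m J) *: (x *m J).
  apply/eqP; rewrite -subr_eq0; apply/eqP; apply: (ip_nondeg Eu) => w.
  have := h w; rewrite ip_sfmetric => /eqP; rewrite !mulf_eq0 invr_eq0.
  rewrite pnatr_eq0 /= (negPf c0) /= => /eqP hw.
  have : nform x (v - (hdlog x v *: x - hdlog x (v *m J) *: (x *m J))) w = 0.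
    by rewrite !nformE nformJl -hw /hdlog; ring.
  by move/eqP; rewrite mulf_eq0 invr_eq0 (negPf r0) orbF => /eqP.
have pxx : hdlog x x = 1 - e / rho x.
  by rewrite /hdlog /nform /rho; field; exact: r0.
have solve t : t = t * (1 - e / rho x) -> t = 0.
  move=> ht; have /eqP : t * (e / rho x) = 0.
    by transitivity (t - t * (1 - e / rho x)); [ring | rewrite -ht subrr].
  by rewrite mulf_eq0 (negPf (mulf_neq0 e0 (invr_neq0 r0))) orbF => /eqP.
have pv : hdlog x v = 0.
  have := congr1 (hdlog x) vE; rewrite !hdlogE hdlogxJ pxx mulr0 subr0.
  exact: solve.
have pJv : hdlog x (v *m J) = 0.
  have := congr1 (fun z => hdlog x (z *m J)) vE.
  rewrite mulmxBl -!scalemxAl mulJJ !hdlogE hdlogxJ pxx mulr0 add0r mulrN opprK.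
  exact: solve.
by rewrite vE pv pJv !scale0r subr0.
Qed.

Lemma sfconn_sym x v w : sfconn x v w = sfconn x w v.
Proof.
rewrite /sfconn; congr (- _); rewrite [X in X - _ - _]addrC -!addrA.
by congr (_ + (_ + _)); rewrite addrC.
Qed.

(** [sfconn] is complex bilinear; this is what makes [J] parallel. *)
Lemma sfconnJ x v w : sfconn x v (w *m J) = sfconn x v w *m J.
Proof.
rewrite /sfconn mulNmx !mulmxBl mulmxDl -!scalemxAl !mulJJ hdlogN; congr (- _).
by apply/rowP => i; rewrite !mxE; ring.
Qed.

Lemma sfconn_linearr x v : linear (sfconn x v).
Proof.
move=> a w z; rewrite /sfconn mulmxDl -!scalemxAl !hdlogE.
by apply/rowP => i; rewrite !mxE; ring.
Qed.

Lemma sfconn_linearl x w : linear ((sfconn x)^~ w).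
Proof.
by move=> a v z /=; rewrite ![sfconn x _ w]sfconn_sym; exact: sfconn_linearr.
Qed.

(** * Derivatives along a map into the space form *)

Section Along.
Variables (V : normedModType R) (F : V -> 'rV[R]_k) (u v : V) (a : 'rV[R]_k).
Hypotheses (Fa : is_derive u v F a) (r0 : rho (F u) != 0).
Local Notation x := (F u).

Lemma is_derive_rhoV :
  is_derive u v (fun y => (rho (F y))^-1) (- (2 * hdlog x a) / rho x).
Proof.
have h : is_derive u v (fun y => rho (F y)) (2 * (hdlog x a * rho x)).
  rewrite (_ : (fun y => _) = cst e + (fun y => ip E (F y) (F y)));
    last exact: erefl.
  apply: is_derive_eq (is_deriveD (is_derive_cst e u v) (is_derive_ip E Fa Fa)) _.
  by rewrite add0r (ipE_sym a) /hdlog /nform divfK //; ring.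
apply: is_derive_eq (@is_derive_inv R V (fun y => rho (F y)) u v _ r0 h) _.
by field.
Qed.

Lemma is_derive_nform (W Z : V -> 'rV[R]_k) dW dZ :
  is_derive u v W dW -> is_derive u v Z dZ ->
  is_derive u v (fun y => nform (F y) (W y) (Z y))
    (nform x dW (Z u) + nform x (W u) dZ - 2 * hdlog x a * nform x (W u) (Z u)).
Proof.
move=> hW hZ.
apply: is_derive_eq (is_deriveM (is_derive_ip E hW hZ) is_derive_rhoV) _.
rewrite /nform /GRing.scale /=.
move: (hdlog x a) (ip E dW _) (ip E (W u) dZ) (ip E (W u) _) => p b1 b2 b3.
by field.
Qed.

Lemma is_derive_hdlog (W : V -> 'rV[R]_k) dW :
  is_derive u v W dW ->
  is_derive u v (fun y => hdlog (F y) (W y))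
    (nform x a (W u) + hdlog x dW - 2 * hdlog x a * hdlog x (W u)).
Proof. exact: is_derive_nform. Qed.

(** Compatibility of [sfconn] with the metric, along any map [F] into the
    chart. For [F = id] it identifies the Levi-Civita connection; for [F] a
    hypersurface it differentiates inner products of fields along [F]. *)
Lemma is_derive_sfmetric (W Z : V -> 'rV[R]_k) dW dZ :
  is_derive u v W dW -> is_derive u v Z dZ ->
  is_derive u v (fun y => ip (sfmetric (F y)) (W y) (Z y))
    (ip (sfmetric x) (dW + sfconn x a (W u)) (Z u) +
     ip (sfmetric x) (W u) (dZ + sfconn x a (Z u))).
Proof.
move=> hW hZ.
have hWJ := is_derive_mulmxr J hW; have hZJ := is_derive_mulmxr J hZ.
rewrite (_ : (fun y => _) = cst (4 / c) * ((fun y => nform (F y) (W y) (Z y))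
  - (fun y => hdlog (F y) (W y)) * (fun y => hdlog (F y) (Z y))
  - (fun y => hdlog (F y) (W y *m J)) * (fun y => hdlog (F y) (Z y *m J)))); last first.
  by apply/funext => y; rewrite ip_sfmetric.
have d1 := is_deriveM (is_derive_hdlog hW) (is_derive_hdlog hZ).
have d2 := is_deriveM (is_derive_hdlog hWJ) (is_derive_hdlog hZJ).
apply: is_derive_eq (is_deriveM (is_derive_cst (4 / c) u v)
  (is_deriveB (is_deriveB (is_derive_nform hW hZ) d1) d2)) _.
rewrite !ip_sfmetric scaler0 addr0 /cst /GRing.scale /= -mulrDr; congr (_ * _).
rewrite /sfconn !(mulmxDl, mulNmx) -!scalemxAl !mulJJ !(hdlogE, nformE).
rewrite !nformJl [nform x (W u) a]nform_sym.
rewrite !(nform_sym x (W u) (_ *m J)) !nformJl.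
by ring.
Qed.

Lemma is_derive_sfconn (A W : V -> 'rV[R]_k) dA dW :
  is_derive u v A dA -> is_derive u v W dW ->
  is_derive u v (fun y => sfconn (F y) (A y) (W y))
    (- ((nform x a (A u) + hdlog x dA - 2 * hdlog x a * hdlog x (A u)) *: W u
        + hdlog x (A u) *: dW
        + ((nform x a (W u) + hdlog x dW - 2 * hdlog x a * hdlog x (W u)) *: A u
        + hdlog x (W u) *: dA)
        - ((nform x a (A u *m J) + hdlog x (dA *m J)
            - 2 * hdlog x a * hdlog x (A u *m J)) *: (W u *m J)
        + hdlog x (A u *m J) *: (dW *m J))
        - ((nform x a (W u *m J) + hdlog x (dW *m J)
            - 2 * hdlog x a * hdlog x (W u *m J)) *: (A u *m J)
        + hdlog x (W u *m J) *: (dA *m J)))).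
Proof.
move=> hA hW.
have hAJ := is_derive_mulmxr J hA; have hWJ := is_derive_mulmxr J hW.
have d1 := is_derive_scale (is_derive_hdlog hA) hW.
have d2 := is_derive_scale (is_derive_hdlog hW) hA.
have d3 := is_derive_scale (is_derive_hdlog hAJ) hWJ.
have d4 := is_derive_scale (is_derive_hdlog hWJ) hAJ.
exact: (is_deriveN (is_deriveB (is_deriveB (is_deriveD d1 d2) d3) d4)).
Qed.

End Along.

(** The covariant derivative, in the direction [v], of a field [W] along [F]. *)
Definition nab (m : nat) (F : 'rV[R]_m -> 'rV[R]_k) (v : 'rV[R]_m)
    (W : 'rV[R]_m -> 'rV[R]_k) (u : 'rV[R]_m) : 'rV[R]_k :=
  'D_v W u + sfconn (F u) ('D_v F u) (W u).

(** The curvature tensor of constant holomorphic sectional curvature [c]. *)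
Definition sfcurv x a b w : 'rV[R]_k :=
  (c / 4) *: (ip (sfmetric x) b w *: a - ip (sfmetric x) a w *: b
    + ip (sfmetric x) (b *m J) w *: (a *m J)
    - ip (sfmetric x) (a *m J) w *: (b *m J)
    - (2 * ip (sfmetric x) (a *m J) b) *: (w *m J)).

(** The computation behind [nab_curv]. The hypotheses on [X] and [Y] are the two
    iterated derivatives given by [is_derive_sfconn], where [a], [b] are the
    derivatives of [F], [t] and [t'] its mixed derivatives, [Wv], [Ww] the
    derivatives of [W] and [Wvw], [Wwv] its mixed derivatives; the mixed ones
    are identified by the first two hypotheses. *)
Lemma sfcurv_identity x a b t t' W Wv Ww Wvw Wwv X Y :
  Wwv = Wvw -> t' = t ->
  X = Wvw - ((nform x a b + hdlog x t - 2 * hdlog x a * hdlog x b) *: W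
        + hdlog x b *: Wv
        + ((nform x a W + hdlog x Wv - 2 * hdlog x a * hdlog x W) *: b
        + hdlog x W *: t)
        - ((nform x a (b *m J) + hdlog x (t *m J)
            - 2 * hdlog x a * hdlog x (b *m J)) *: (W *m J)
        + hdlog x (b *m J) *: (Wv *m J))
        - ((nform x a (W *m J) + hdlog x (Wv *m J)
            - 2 * hdlog x a * hdlog x (W *m J)) *: (b *m J)
        + hdlog x (W *m J) *: (t *m J))) ->
  Y = Wwv - ((nform x b a + hdlog x t' - 2 * hdlog x b * hdlog x a) *: W
        + hdlog x a *: Ww
        + ((nform x b W + hdlog x Ww - 2 * hdlog x b * hdlog x W) *: a
        + hdlog x W *: t')
        - ((nform x b (a *m J) + hdlog x (t' *m J)
            - 2 * hdlog x b * hdlog x (a *m J)) *: (W *m J)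
        + hdlog x (a *m J) *: (Ww *m J))
        - ((nform x b (W *m J) + hdlog x (Ww *m J)
            - 2 * hdlog x b * hdlog x (W *m J)) *: (a *m J)
        + hdlog x (W *m J) *: (t' *m J))) ->
  (X + sfconn x a (Ww + sfconn x b W))
  - (Y + sfconn x b (Wv + sfconn x a W)) = sfcurv x a b W.
Proof.
move=> -> -> -> ->; rewrite /sfcurv !ip_sfmetric.
rewrite /sfconn !(mulmxDl, mulNmx) -!scalemxAl !mulJJ !(hdlogE, nformE).
rewrite (nform_sym x b a) !nformJl (nform_sym x b (a *m J)) !nformJl.
have -> s1 s2 s3 s4 s5 (y1 y2 y3 y4 y5 : 'rV[R]_k) :
  (c / 4) *: ((4 / c * s1) *: y1 - (4 / c * s2) *: y2 + (4 / c * s3) *: y3 -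
     (4 / c * s4) *: y4 - (2 * (4 / c * s5)) *: y5) =
  s1 *: y1 - s2 *: y2 + s3 *: y3 - s4 *: y4 - (2 * s5) *: y5.
  by apply/rowP => i; rewrite !mxE; field.
apply/rowP => i; rewrite !mxE -![\sum_j _ * _]/(_).
have E1 z : \sum_j z 0 j * J j i = (z *m J) 0 i by rewrite mxE.
rewrite !E1.
move: (W 0 i) (Wv 0 i) (Ww 0 i) (Wvw 0 i) (a 0 i) (b 0 i) (t 0 i)
  ((W *m J) 0 i) ((Wv *m J) 0 i) ((Ww *m J) 0 i) ((a *m J) 0 i) ((b *m J) 0 i)
  ((t *m J) 0 i) => w1 w2 w3 w4 w5 w6 w7 w8 w9 w10 w11 w12 w13.
by ring.
Qed.

(** Curvature of the connection pulled back by [F]. There is no bracket term as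
    [v] and [w] are constant. *)
Lemma nab_curv (m : nat) (U : set 'rV[R]_m) (F W : 'rV[R]_m -> 'rV[R]_k)
    (u v w : 'rV[R]_m) :
  open U -> smooth_on U F -> smooth_on U W -> U u ->
  (forall y, U y -> rho (F y) != 0) ->
  nab F v (nab F w W) u - nab F w (nab F v W) u =
  sfcurv (F u) ('D_v F u) ('D_w F u) (W u).
Proof.
move=> oU sF sW Uu r0.
have dgam (v' w' : 'rV[R]_m) :=
  is_derive_sfconn (smooth_is_derive v' sF Uu) (r0 u Uu)
    (smooth_is_derive v' (smooth_derive oU w' sF) Uu) (smooth_is_derive v' sW Uu).
have dnab (v' w' : 'rV[R]_m) :=
  is_deriveD (smooth_is_derive v' (smooth_derive oU w' sW) Uu) (dgam v' w').
have dnabE (v' w' : 'rV[R]_m) : 'D_v' (nab F w' W) u = _ :=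
  is_derive_value (dnab v' w').
have cW := smooth_derive_comm v w oU sW Uu.
have cF := smooth_derive_comm v w oU sF Uu.
exact: (sfcurv_identity cW cF (dnabE v w) (dnabE w v)).
Qed.

(** Case [F = id] of [is_derive_sfmetric], for constant fields. *)
Lemma Gam_sfmetric x v w : rho x != 0 -> Gam sfmetric x v w = sfconn x v w.
Proof.
move=> r0; apply: levi_civita_unique; [|exact: sfmetric_sym|exact: sfconn_linearl|
  exact: sfconn_linearr|exact: sfconn_sym|].
  by apply: nondeg_unit => z; exact: sfmetric_nondeg.
move=> l i j; rewrite /pd.
have := @is_derive_sfmetric _ id x (delta_mx 0 l) (delta_mx 0 l)
  (is_derive_id _ _) r0 (cst (delta_mx 0 i)) (cst (delta_mx 0 j)) 0 0
  (is_derive_cst _ _ _) (is_derive_cst _ _ _).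
rewrite !add0r /cst => h.
have -> : (fun y => sfmetric y i j) =
    (fun y => ip (sfmetric y) (delta_mx 0 i) (delta_mx 0 j)).
  by apply/funext => y; rewrite ip_delta -rowE [RHS]mxE.
exact: (is_derive_value h).
Qed.

Section Fields.
Variables (m : nat) (F : 'rV[R]_m -> 'rV[R]_k) (u v : 'rV[R]_m).
Hypotheses (derivable_F : derivable F u v) (r0 : rho (F u) != 0).

Lemma nab_compat (W Z : 'rV[R]_m -> 'rV[R]_k) :
  derivable W u v -> derivable Z u v ->
  is_derive u v (fun y => ip (sfmetric (F y)) (W y) (Z y))
    (ip (sfmetric (F u)) (nab F v W u) (Z u) +
     ip (sfmetric (F u)) (W u) (nab F v Z u)).
Proof.
move=> dW dZ.
exact: (is_derive_sfmetric (derivableP derivable_F) r0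
  (derivableP dW) (derivableP dZ)).
Qed.

Lemma nabJ (W : 'rV[R]_m -> 'rV[R]_k) : derivable W u v ->
  nab F v (fun y => W y *m J) u = nab F v W u *m J.
Proof.
move=> dW; rewrite /nab mulmxDl -sfconnJ.
by rewrite (is_derive_value (is_derive_mulmxr J (derivableP dW))).
Qed.

Lemma nabD (W Z : 'rV[R]_m -> 'rV[R]_k) : derivable W u v -> derivable Z u v ->
  nab F v (fun y => W y + Z y) u = nab F v W u + nab F v Z u.
Proof.
move=> dW dZ; rewrite /nab.
rewrite (is_derive_value (is_deriveD (derivableP dW) (derivableP dZ))).
have := sfconn_linearr (F u) ('D_v F u) 1 (W u) (Z u); rewrite !scale1r => ->.
by rewrite addrACA.
Qed.

Lemma nabZ (s : 'rV[R]_m -> R) (W : 'rV[R]_m -> 'rV[R]_k) :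
  derivable s u v -> derivable W u v ->
  nab F v (fun y => s y *: W y) u = 'D_v s u *: W u + s u *: nab F v W u.
Proof.
move=> ds dW; rewrite /nab.
rewrite (is_derive_value (is_derive_scale (derivableP ds) (derivableP dW))).
have := sfconn_linearr (F u) ('D_v F u) (s u) (W u) 0; rewrite addr0 => ->.
have -> : sfconn (F u) ('D_v F u) 0 = 0.
  have := sfconn_linearr (F u) ('D_v F u) (-1) 0 0.
  by rewrite scaleN1r oppr0 addr0 => {1}->; rewrite scaleN1r addNr.
by rewrite addr0 scalerDr addrA.
Qed.

Lemma nab_near (W Z : 'rV[R]_m -> 'rV[R]_k) :
  (\forall y \near u, W y = Z y) -> nab F v W u = nab F v Z u.
Proof.
by move=> WZ; rewrite /nab (near_eq_derive v WZ) (nbhs_singleton WZ).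
Qed.

End Fields.

(** * The equations of Weingarten and Gauss *)

Section Hyper.
Variables (m : nat) (U : set 'rV[R]_m) (F N : 'rV[R]_m -> 'rV[R]_k).
Hypotheses (oU : open U) (sF : smooth_on U F) (sN : smooth_on U N).
Implicit Types (u : 'rV[R]_m) (a b : 'rV[R]_k).
Hypotheses (km : k = m.+1) (r0 : forall u, U u -> rho (F u) != 0).
Hypothesis Ffree : forall u, U u -> row_free (jacobian F u).
Hypothesis Ntan : forall u, U u -> forall v,
  ip (sfmetric (F u)) (N u) (v *m jacobian F u) = 0.
Hypothesis Nunit : forall u, U u -> ip (sfmetric (F u)) (N u) (N u) = 1.
Local Notation G u := (sfmetric (F u)).
Local Notation D u := (jacobian F u).
Local Notation gI := (indmet sfmetric F).
Local Notation tg := (tang sfmetric F).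
Local Notation A := (Defs.shape sfmetric F N).

Lemma derive_F u v : U u -> 'D_v F u = v *m D u.
Proof. by move=> Uu; apply: deriveEjacobian; exact: smooth_differentiable sF Uu. Qed.

Lemma ip_indmet u v w : ip (gI u) v w = ip (G u) (v *m D u) (w *m D u).
Proof. by rewrite /ip /indmet trmx_mul !mulmxA. Qed.

Lemma indmet_sym u : (gI u)^T = gI u.
Proof. by rewrite /indmet !trmx_mul trmxK sfmetric_sym mulmxA. Qed.

Lemma Gsym u a b : ip (G u) a b = ip (G u) b a.
Proof. exact/ip_sym/sfmetric_sym. Qed.

Lemma GJl u a b : ip (G u) (a *m J) b = - ip (G u) a (b *m J).
Proof. by rewrite -(sfmetricJ _ a) mulJJ ipNr opprK. Qed.

Lemma GJ0 u a : ip (G u) a (a *m J) = 0.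
Proof.
have /eqP : ip (G u) a (a *m J) = - ip (G u) a (a *m J) by rewrite -GJl Gsym.
by rewrite -addr_eq0 -mulr2n mulrn_eq0 /= => /eqP.
Qed.

(** The rows of the jacobian together with the unit normal form a basis: there
    are [m + 1 = n + n] of them and [N u] is not tangent, being orthogonal to the
    tangent space without being isotropic. *)
Lemma orth_eq0 u y : U u -> (forall v, ip (G u) y (v *m D u) = 0) ->
  ip (G u) y (N u) = 0 -> y = 0.
Proof.
move=> Uu yD yN; apply: sfmetric_nondeg (r0 Uu) _ => w.
pose K := col_mx (D u) (N u).
have Kfree : row_free K.
  apply: inj_row_free => s; rewrite -[s]hsubmxK mul_row_col.
  rewrite [rsubmx s]mx11_scalar mul_scalar_mx => sK.
  have s0 : rsubmx s 0 0 = 0.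
    have := congr1 (fun z => ip (G u) (N u) z) sK.
    by rewrite ipDr Ntan // ipZr Nunit // mulr1 add0r ip0r.
  rewrite s0 scale0r addr0 in sK; rewrite s0.
  have l0 : lsubmx s = 0 by apply: (row_free_inj (Ffree Uu)); rewrite mul0mx.
  by rewrite l0 raddf0 row_mx0.
have Kfull : row_full K.
  have /eqP rK : \rank K == (m + 1)%N := Kfree.
  by rewrite /row_full rK addn1; apply/eqP.
have /row_fullP[L LK] := Kfull.
have -> : w = (w *m L) *m K by rewrite -mulmxA LK mulmx1.
rewrite -[w *m L]hsubmxK mul_row_col ipDr yD add0r.
by rewrite [rsubmx _]mx11_scalar mul_scalar_mx ipZr yN mulr0.
Qed.

Lemma indmet_unit u : U u -> gI u \in unitmx.
Proof.
move=> Uu; apply: nondeg_unit => v h.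
apply: (row_free_inj (Ffree Uu)); rewrite mul0mx; apply: (orth_eq0 Uu).
  by move=> w; rewrite -ip_indmet.
by rewrite Gsym Ntan.
Qed.

Lemma tang_ip u w v : U u -> ip (gI u) (tg u w) v = ip (G u) w (v *m D u).
Proof.
move=> Uu; rewrite /ip /tang mulmxKV ?indmet_unit //.
by rewrite trmx_mul !mulmxA.
Qed.

Lemma tang_split u w : U u ->
  w = tg u w *m D u + ip (G u) w (N u) *: N u.
Proof.
move=> Uu; apply/eqP; rewrite -subr_eq0; apply/eqP; apply: (orth_eq0 Uu).
  move=> v; rewrite ipDl ipNl ipDl -ip_indmet tang_ip // ipZl Ntan //.
  by rewrite mulr0 addr0 subrr.
rewrite ipDl ipNl ipDl ipZl Nunit // mulr1 (Gsym _ (_ *m _)) Ntan //.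
by rewrite add0r subrr.
Qed.

Lemma tangD u a b : tg u (a + b) = tg u a + tg u b.
Proof. by rewrite /tang !mulmxDl. Qed.
Lemma tangZ u s a : tg u (s *: a) = s *: tg u a.
Proof. by rewrite /tang -!scalemxAl. Qed.
Lemma tangN u a : tg u (- a) = - tg u a.
Proof. by rewrite /tang !mulNmx. Qed.

Lemma tang_tan u v : U u -> tg u (v *m D u) = v.
Proof.
move=> Uu; rewrite /tang -(mulmxA v) -(mulmxA v) mulmxK //.
exact: indmet_unit.
Qed.

Lemma tang_normal u : U u -> tg u (N u) = 0.
Proof.
move=> Uu; apply: (ip_nondeg (indmet_unit Uu)) => w.
by rewrite tang_ip // Ntan.
Qed.

Lemma derivable_F u v : U u -> derivable F u v.
Proof. by move=> Uu; exact/diff_derivable/(smooth_differentiable sF Uu). Qed.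
Lemma derivable_N u v : U u -> derivable N u v.
Proof. by move=> Uu; exact/diff_derivable/(smooth_differentiable sN Uu). Qed.
Lemma smooth_DF w : smooth_on U ('D_w F).
Proof. exact: smooth_derive. Qed.
Lemma derivable_DF u v w : U u -> derivable ('D_w F) u v.
Proof.
by move=> Uu; exact/diff_derivable/(smooth_differentiable (smooth_DF w) Uu).
Qed.

Lemma nabla_alongE u v : U u -> nabla_along sfmetric F v N u = nab F v N u.
Proof.
by move=> Uu; rewrite /nabla_along /nab Gam_sfmetric ?r0 // derive_F.
Qed.

Definition second_form u v w : R := ip (G u) (nab F v ('D_w F) u) (N u).

Lemma nab_normal u v : U u -> ip (G u) (nab F v N u) (N u) = 0.
Proof.
move=> Uu; have h := nab_compat (v := v) (derivable_F Uu) (r0 Uu)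
  (derivable_N Uu) (derivable_N Uu).
have : \forall y \near u, cst 1 y = ip (G y) (N y) (N y).
  by apply: (near_open oU Uu) => y Uy; rewrite Nunit.
move/(near_eq_derive v); rewrite derive_cst (is_derive_value h).
rewrite (Gsym _ (N u)) => /esym/eqP.
by rewrite -mulr2n mulrn_eq0 /= => /eqP.
Qed.

(** The derivative of the unit normal has no normal component, as one sees by
    differentiating [g (N, N) = 1]. *)
Lemma weingarten u v : U u -> nab F v N u = - (A u v *m D u).
Proof.
move=> Uu; rewrite {1}(tang_split (nab F v N u) Uu) nab_normal // scale0r addr0.
by rewrite /Defs.shape nabla_alongE // tangN mulNmx opprK.
Qed.

(** Differentiate [g (N, 'D_w F) = 0]. *)
Lemma second_form_shape u v w : U u -> second_form u v w = ip (gI u) (A u v) w.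
Proof.
move=> Uu; have h := nab_compat (v := v) (derivable_F Uu) (r0 Uu)
  (derivable_N Uu) (derivable_DF (w := w) Uu).
have : \forall y \near u, cst 0 y = ip (G y) (N y) ('D_w F y).
  by apply: (near_open oU Uu) => y Uy; rewrite derive_F // Ntan.
move/(near_eq_derive v); rewrite derive_cst (is_derive_value h).
rewrite weingarten // ipNl derive_F // -ip_indmet => /esym/eqP.
by rewrite addrC subr_eq0 Gsym => /eqP.
Qed.

(** The pulled back connection is torsion free: symmetry of the second
    derivatives of [F] and of [sfconn]. *)
Lemma nab_torsion u v w : U u -> nab F v ('D_w F) u = nab F w ('D_v F) u.
Proof.
move=> Uu; exact: (f_equal2 +%R (smooth_derive_comm w v oU sF Uu)
  (sfconn_sym (F u) ('D_v F u) ('D_w F u))).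
Qed.

Lemma second_form_sym u v w : U u -> second_form u v w = second_form u w v.
Proof. by move=> Uu; rewrite /second_form nab_torsion. Qed.

Lemma shape_sa u v w : U u -> ip (gI u) (A u v) w = ip (gI u) v (A u w).
Proof.
move=> Uu; rewrite -second_form_shape // second_form_sym // second_form_shape //.
exact/ip_sym/indmet_sym.
Qed.

Lemma nab_linear u v : U u -> linear (fun w => nab F v ('D_w F) u).
Proof.
move=> Uu s w z.
have Ew : \forall y \near u,
    'D_(s *: w + z) F y = cst s y *: 'D_w F y + 'D_z F y.
  apply: (near_open oU Uu) => y Uy.
  by rewrite !derive_F // mulmxDl -scalemxAl.
rewrite (nab_near F v Ew) nabD; first last.
- exact: derivable_DF.
- exact: (is_derive_derivable (is_derive_scale (is_derive_cst s u v)
    (derivableP (derivable_DF Uu)))).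
- rewrite (nabZ F (derivable_cst s u v) (derivable_DF (w := w) Uu)).
  by rewrite derive_cst scale0r add0r.
Qed.

Lemma derivable_G u v : U u -> derivable (fun y => G y) u v.
Proof.
move=> Uu; apply/derivable_mxP => i j.
have := nab_compat (v := v) (derivable_F Uu) (r0 Uu)
   (derivable_cst (delta_mx 0 i) u v) (derivable_cst (delta_mx 0 j) u v).
move=> /is_derive_derivable.
suff -> : (fun y => ip (G y) (cst (delta_mx 0 i) y) (cst (delta_mx 0 j) y)) =
          (fun y => G y i j) by [].
by apply/funext => y; rewrite ip_delta -rowE [LHS]mxE.
Qed.

Lemma derivable_D u v : U u -> derivable (fun y => D y) u v.
Proof.
move=> Uu; apply/derivable_mxP => i j.
have h : derivable (fun y => 'D_(delta_mx 0 i) F y 0 j) u v.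
  exact: ((derivable_mxP ('D_(delta_mx 0 i) F) u v).1 (derivable_DF Uu) 0 j).
apply: near_eq_derivable h; apply: (near_open oU Uu) => y Uy.
by rewrite derive_F // -rowE mxE.
Qed.

Lemma derivable_mulmx p q r (X : 'rV[R]_m -> 'M[R]_(p, q))
    (Y : 'rV[R]_m -> 'M[R]_(q, r)) u v :
  derivable X u v -> derivable Y u v -> derivable (fun y => X y *m Y y) u v.
Proof.
move=> dX dY.
exact: (is_derive_derivable (is_derive_mulmx (derivableP dX) (derivableP dY))).
Qed.

Lemma derivable_DT u v : U u -> derivable (fun y => (D y)^T) u v.
Proof.
move=> Uu.
exact: (is_derive_derivable (is_derive_trmx (derivableP (derivable_D Uu)))).
Qed.

Lemma derivable_indmet u v : U u -> derivable gI u v.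
Proof.
move=> Uu; apply: derivable_mulmx (derivable_DT Uu).
by apply: derivable_mulmx; [exact: derivable_D | exact: derivable_G].
Qed.

Lemma derivable_tang u v (W : 'rV[R]_m -> 'rV[R]_k) : U u ->
  derivable W u v -> derivable (fun y => tg y (W y)) u v.
Proof.
move=> Uu dW.
have dI : derivable (fun y => invmx (gI y)) u v.
  apply: derivable_invmx; last exact: derivable_indmet.
  by apply: (near_open oU Uu) => y; exact: indmet_unit.
have dWG := derivable_mulmx dW (derivable_G Uu).
exact: (derivable_mulmx (derivable_mulmx dWG (derivable_DT Uu)) dI).
Qed.

Lemma derivable_nab u v w (W : 'rV[R]_m -> 'rV[R]_k) : U u ->
  smooth_on U W -> derivable (nab F w W) u v.
Proof.
move=> Uu sW.
have d1 := smooth_is_derive v (smooth_derive oU w sW) Uu.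
have d2 := is_derive_sfconn (smooth_is_derive v sF Uu) (r0 Uu)
   (smooth_is_derive v (smooth_DF w) Uu) (smooth_is_derive v sW Uu).
exact: (is_derive_derivable (is_deriveD d1 d2)).
Qed.

Lemma tang_ipD u a w : U u -> ip (gI u) (tg u a) w = ip (G u) a ('D_w F u).
Proof. by move=> Uu; rewrite tang_ip // (derive_F w Uu). Qed.

(** The tangential part of the ambient derivative is torsion free and compatible
    with the induced metric, hence it is its Levi-Civita connection. *)
Lemma Gam_indmet u v w : U u -> Gam gI u v w = tg u (nab F v ('D_w F) u).
Proof.
move=> Uu.
apply: (levi_civita_unique (T := fun v w => tg u (nab F v ('D_w F) u))).
- exact: indmet_unit.
- exact: indmet_sym.
- move=> z s a b /=; rewrite !(nab_torsion _ z Uu) -tangZ -tangD.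
  by congr (tg u _); exact: nab_linear.
- move=> z s a b /=; rewrite -tangZ -tangD.
  by congr (tg u _); exact: nab_linear.
- by move=> a b; rewrite nab_torsion.
move=> l i j; rewrite [X in _ = _ + X](ip_sym _ _ (indmet_sym u)).
have h := nab_compat (v := delta_mx 0 l) (derivable_F Uu) (r0 Uu)
  (derivable_DF (w := delta_mx 0 i) Uu) (derivable_DF (w := delta_mx 0 j) Uu).
apply: etrans (etrans (is_derive_value h) _).
  rewrite /pd; apply: near_eq_derive; apply: (near_open oU Uu) => y Uy.
  by rewrite (derive_F _ Uy) (derive_F _ Uy) -ip_indmet ip_delta -rowE [RHS]mxE.
exact/esym/(f_equal2 +%R (tang_ipD _ _ Uu)
  (etrans (tang_ipD _ _ Uu) (Gsym _ _ _))).
Qed.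

(** Product rule for a tangent field whose components [T] vary: freezing [T] at
    [u] leaves a constant direction, to which [Gam_indmet] applies. *)
Lemma nab_tangent u v (T : 'rV[R]_m -> 'rV[R]_m) : U u -> derivable T u v ->
  nab F v (fun y => T y *m D y) u =
  'D_v T u *m D u + nab F v ('D_(T u) F) u.
Proof.
move=> Uu dT; have dD := derivableP (derivable_D (v := v) Uu).
have h := is_derive_mulmx (derivableP dT) dD.
have near2 : \forall y \near u, 'D_(T u) F y = cst (T u) y *m D y.
  by apply: (near_open oU Uu) => y; exact: derive_F.
have h2 := is_derive_mulmx (is_derive_cst (T u) u v) dD.
rewrite (nab_near F v near2) /nab (is_derive_value h).
by rewrite (is_derive_value h2) mul0mx add0r addrA.
Qed.

Lemma derivable_second_form u v w t : U u ->
  derivable (fun y => second_form y w t) u v.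
Proof.
move=> Uu.
have d := derivable_nab (v := v) (w := w) Uu (smooth_DF t).
have h := nab_compat (v := v) (derivable_F Uu) (r0 Uu) d (derivable_N Uu).
exact: (is_derive_derivable h).
Qed.

Lemma nabla_const u w t : U u ->
  nabla gI (fun=> w) (fun=> t) u = tg u (nab F w ('D_t F) u).
Proof. by move=> Uu; rewrite /nabla derive_cst add0r Gam_indmet. Qed.

(** Gauss formula at second order: differentiate the splitting of
    [nab F w ('D_t F)] into tangential and normal parts, and use
    [weingarten] for the derivative of the normal part. *)
Lemma nabla2_const u v w t : U u ->
  nabla gI (fun=> v) (nabla gI (fun=> w) (fun=> t)) u =
  tg u (nab F v (nab F w ('D_t F)) u) + second_form u w t *: A u v.
Proof.
move=> Uu; pose T y := tg y (nab F w ('D_t F) y).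
have dT : derivable T u v.
  by apply: derivable_tang => //; exact: derivable_nab Uu (smooth_DF t).
have nT : \forall y \near u, nabla gI (fun=> w) (fun=> t) y = T y.
  by apply: (near_open oU Uu) => y; exact: nabla_const.
have -> : nabla gI (fun=> v) (nabla gI (fun=> w) (fun=> t)) u =
    'D_v T u + tg u (nab F v ('D_(T u) F) u).
  rewrite -(Gam_indmet _ _ Uu) -(near_eq_derive v nT) -(nbhs_singleton nT).
  exact: erefl.
have nS : \forall y \near u,
    nab F w ('D_t F) y = T y *m D y + second_form y w t *: N y.
  by apply: (near_open oU Uu) => y Uy; exact: tang_split.
have dS := derivable_second_form (v := v) (w := w) (t := t) Uu.
have dSN := is_derive_derivable
  (is_derive_scale (derivableP dS) (derivableP (derivable_N Uu))).
have dTD := derivable_mulmx dT (derivable_D Uu).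
rewrite (nab_near F v nS) (nabD F dTD dSN) (nab_tangent Uu dT).
rewrite (nabZ F dS (derivable_N Uu)) (weingarten v Uu).
move: (nab F v ('D_(T u) F) u) => X1.
rewrite !tangD !tangZ tangN !(tang_tan _ Uu) (tang_normal Uu).
by rewrite scaler0 add0r scalerN subrK.
Qed.

(** The curvature antisymmetrizes [nabla2_const]; its ambient part is
    [nab_curv]. *)
Lemma gauss u v w t : U u ->
  riem gI u v w t =
  tg u (sfcurv (F u) (v *m D u) (w *m D u) (t *m D u))
    + second_form u w t *: A u v - second_form u v t *: A u w.
Proof.
move=> Uu; rewrite /riem /curv !nabla2_const //.
have -> : nabla gI (lie (fun=> v) (fun=> w)) (fun=> t) u = 0.
  rewrite /nabla /lie !derive_cst subrr add0r; apply/rowP => l; rewrite !mxE.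
  by rewrite big1 // => i _; rewrite big1 // => j _; rewrite mxE mulr0 mul0r.
rewrite subr0 -!derive_F // -(nab_curv v w oU sF (smooth_DF t) Uu r0).
by rewrite tangD tangN opprD !addrA; congr (_ - _); rewrite addrAC.
Qed.

(** * The almost contact structure *)

(** The structure tensors of the hypersurface, with multiplication by [i]
    written as the matrix [J]. *)
Definition xiJ u : 'rV[R]_m := tg u (- (N u *m J)).
Definition phiJ u v : 'rV[R]_m := tg u (v *m D u *m J).
Definition etaJ u v : R := ip (gI u) v (xiJ u).

Lemma xiJ_tangent u : U u -> xiJ u *m D u = - (N u *m J).
Proof.
move=> Uu; rewrite [RHS](tang_split _ Uu) ipNl GJl GJ0 !oppr0 scale0r addr0.
exact: erefl.
Qed.

Lemma etaJ_normal u v : U u -> etaJ u v = ip (G u) (v *m D u *m J) (N u).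
Proof. by move=> Uu; rewrite /etaJ ip_indmet xiJ_tangent // ipNr GJl. Qed.

Lemma phiJ_split u v : U u -> v *m D u *m J = phiJ u v *m D u + etaJ u v *: N u.
Proof. by move=> Uu; rewrite {1}(tang_split (v *m D u *m J) Uu) etaJ_normal. Qed.

Lemma etaJ_xi u : U u -> etaJ u (xiJ u) = 1.
Proof.
by move=> Uu; rewrite etaJ_normal // xiJ_tangent // mulNmx mulJJ opprK Nunit.
Qed.

Lemma phiJ_linear u : linear (phiJ u).
Proof.
by move=> s v w; rewrite /phiJ mulmxDl -scalemxAl mulmxDl -scalemxAl tangD tangZ.
Qed.

Lemma shape_linear u : U u -> linear (A u).
Proof.
move=> Uu s v w; apply/eqP; rewrite -subr_eq0; apply/eqP.
apply: (ip_nondeg (indmet_unit Uu)) => y.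
rewrite ipDl ipNl ipDl ipZl !(shape_sa _ _ Uu) ipDl ipZl.
by rewrite subrr.
Qed.

Lemma phiJ_xi u : U u -> phiJ u (xiJ u) = 0.
Proof.
by move=> Uu; rewrite /phiJ xiJ_tangent // mulNmx mulJJ opprK tang_normal.
Qed.

Lemma phiJ_phiJ u v : U u -> phiJ u (phiJ u v) = - v + etaJ u v *: xiJ u.
Proof.
move=> Uu; have E1 := phiJ_split v Uu.
have -> : phiJ u (phiJ u v) = tg u ((v *m D u *m J - etaJ u v *: N u) *m J).
  by rewrite E1 addrK.
rewrite mulmxBl mulJJ -scalemxAl tangD tangN tang_tan // -scalerN.
by rewrite -(mulNmx (N u)) mulNmx tangZ.
Qed.

Lemma phiJ_skew u v w : U u -> ip (gI u) (phiJ u v) w = - ip (gI u) v (phiJ u w).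
Proof.
move=> Uu; rewrite [in RHS](ip_sym _ _ (indmet_sym u)) !tang_ip // GJl.
by rewrite [in RHS]Gsym.
Qed.

(** For [t = xi], that is for [- J N] in the ambient space, the terms of the
    ambient curvature that involve [phi] disappear: they are multiples of inner
    products of the form [g (J X, J N) = g (X, N) = 0] or are normal. *)
Lemma gauss_xi u v w : U u ->
  riem gI u v w (xiJ u) = (c / 4) *: (etaJ u w *: v - etaJ u v *: w)
    + etaJ u (A u w) *: A u v - etaJ u (A u v) *: A u w.
Proof.
move=> Uu; rewrite gauss // !second_form_shape //.
have gx y : ip (G u) (y *m D u) (xiJ u *m D u) = etaJ u y by rewrite -ip_indmet.
have gx0 y : ip (G u) (y *m D u *m J) (xiJ u *m D u) = 0.
  by rewrite xiJ_tangent // ipNr sfmetricJ Gsym Ntan // oppr0.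
rewrite /sfcurv !gx !gx0 !scale0r addr0 subr0 tangZ !tangD !tangN !tangZ.
rewrite !tang_tan // xiJ_tangent // mulNmx mulJJ opprK tang_normal //.
by rewrite scaler0 oppr0 addr0.
Qed.

(** * Local non-existence *)

Section NoNullity.
Variables (ka mu nu : 'rV[R]_m -> R).
Hypothesis m1 : (1 < m)%N.
Hypothesis nu0 : forall u, U u -> nu u != 0.
Hypothesis nul : forall u, U u -> forall v w,
  riem gI u v w (xiJ u) =
    ka u *: (etaJ u w *: v - etaJ u v *: w)
    + mu u *: (etaJ u w *: A u v - etaJ u v *: A u w)
    + nu u *: (etaJ u w *: phiJ u (A u v) - etaJ u v *: phiJ u (A u w)).

(** A linear form on a space of dimension at least 2 has a nonzero kernel. This
    is where [n >= 2] is used. *)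
Lemma exists_horizontal u : exists2 X, X != 0 & etaJ u X = 0.
Proof.
pose L : 'cV[R]_m := gI u *m (xiJ u)^T.
have : kermx L != 0.
  rewrite -mxrank_eq0 mxrank_ker -lt0n subn_gt0.
  exact: leq_ltn_trans (rank_leq_col L) m1.
case/rowV0Pn => X /sub_kermxP XL X0; exists X => //.
by rewrite /etaJ /ip -mulmxA -/L XL mxE.
Qed.

Lemma shape_rank1 u v : U u ->
  A u v = (etaJ u v * etaJ u (A u (xiJ u))) *: xiJ u.
Proof.
move=> Uu; apply: (shape_of_nullity (ph := phiJ u) (g := gI u) (q := c / 4)
  (ka := ka u) (mu := mu u) (nu := nu u)) => //.
- exact: indmet_unit.
- exact: indmet_sym.
- exact: shape_linear.
- by move=> a b; exact: shape_sa.
- exact: phiJ_linear.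
- by move=> a b; exact: phiJ_skew.
- exact: etaJ_xi.
- exact: phiJ_xi.
- by move=> a; exact: phiJ_phiJ.
- by move=> a b; rewrite -/(etaJ _ _) -gauss_xi // nul.
- exact: nu0.
- exact: exists_horizontal.
Qed.

(** The one-form such that the derivative of [N] in the direction [v] is
    [theta(v) J N]. The formula makes its differentiability evident, which the
    expression of [shape_rank1] would not. *)
Definition theta u v : R := ip (G u) (nab F v N u) (N u *m J).

Lemma nab_normal_J u v : U u -> nab F v N u = theta u v *: (N u *m J).
Proof.
move=> Uu; have h : nab F v N u =
    (etaJ u v * etaJ u (A u (xiJ u))) *: (N u *m J).
  by rewrite weingarten // shape_rank1 // -scalemxAl xiJ_tangent // scalerN opprK.
by rewrite /theta h ipZl sfmetricJ Nunit // mulr1.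
Qed.

Lemma derivable_NJ u v : U u -> derivable (fun y => N y *m J) u v.
Proof.
move=> Uu.
exact: (is_derive_derivable (is_derive_mulmxr J (derivableP (derivable_N Uu)))).
Qed.

Lemma derivable_theta u v w : U u -> derivable (fun y => theta y w) u v.
Proof.
move=> Uu; have d := derivable_nab (v := v) (w := w) Uu sN.
have h := nab_compat (v := v) (derivable_F Uu) (r0 Uu) d (derivable_NJ Uu).
exact: (is_derive_derivable h).
Qed.

(** The second term is symmetric in [v] and [w] and disappears from the
    curvature. *)
Lemma nab2_normal u v w : U u -> nab F v (nab F w N) u =
  'D_v (fun y => theta y w) u *: (N u *m J) - (theta u w * theta u v) *: N u.
Proof.
move=> Uu; have nN : \forall y \near u, nab F w N y = theta y w *: (N y *m J).
  by apply: (near_open oU Uu) => y; exact: nab_normal_J.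
rewrite (nab_near F v nN) (nabZ F (derivable_theta Uu) (derivable_NJ Uu)).
rewrite nabJ; last exact: derivable_N.
have eN : nab F v N u *m J = - (theta u v *: N u).
  have := nab_normal_J v Uu; move: (nab F v N u) => Z ->.
  by rewrite -scalemxAl mulJJ scalerN.
apply: (etrans (f_equal (fun Z => _ + theta u w *: Z) eN)).
by rewrite scalerN scalerA.
Qed.

Lemma sfcurv_normal u v : U u -> etaJ u v = 0 ->
  sfcurv (F u) (v *m D u) (xiJ u *m D u) (N u) = (c / 4) *: (v *m D u *m J).
Proof.
move=> Uu v0; rewrite /sfcurv xiJ_tangent // mulNmx mulJJ opprK.
rewrite ipNl GJl GJ0 ipNr sfmetricJ (Gsym _ (_ *m D u)) Ntan // Nunit //.
rewrite -(etaJ_normal v Uu) v0.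
by rewrite !(oppr0, mulr0, scale0r, scale1r, subr0, addr0, add0r).
Qed.

(** For [X] horizontal the curvature [sfcurv X xi N] is [(c / 4) J X] by
    [sfcurv_normal] and a multiple of [J N] by [nab2_normal]; so [X] is normal as
    well as tangent, hence zero. *)
Lemma no_nullity u : ~ U u.
Proof.
move=> Uu; have [X X0 etaX] := exists_horizontal u.
have H := nab_curv X (xiJ u) oU sF sN Uu r0.
have H1 := nab2_normal X (xiJ u) Uu; have H2 := nab2_normal (xiJ u) X Uu.
have H3 := etrans (esym (f_equal2 (fun a b => a - b) H1 H2)) H.
have H4 := f_equal2 (fun a b => sfcurv (F u) a b (N u))
  (derive_F X Uu) (derive_F (xiJ u) Uu).
(* Both sides are compared through this identity on abstract scalars, which
   keeps the derivatives of [theta] closed. *)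
have alg (s1 s2 p p' : R) (x y : 'rV[R]_k) :
    (s1 *: x - (p * p') *: y) - (s2 *: x - (p' * p) *: y) = (s1 - s2) *: x.
  by rewrite (mulrC p') opprB addrA subrK -scalerBl.
have [s] : exists s : R, s *: (N u *m J) = (c / 4) *: (X *m D u *m J).
  have H5 := etrans H3 (etrans H4 (sfcurv_normal Uu etaX)).
  by eexists; exact: etrans (esym (alg _ _ _ _ _ _)) H5.
move/(congr1 (mulmx^~ J)); rewrite /= -!scalemxAl !mulJJ !scalerN => /oppr_inj h.
have s0 : s = 0.
  have := congr1 (fun z => ip (G u) (N u) z) h.
  by rewrite /= !ipZr Nunit // mulr1 Ntan // mulr0.
move/esym/eqP: h; rewrite s0 scale0r scaler_eq0 mulf_eq0 invr_eq0 (negPf c0).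
rewrite pnatr_eq0 /= => /eqP XD; case/negP: X0; apply/eqP/(row_free_inj (Ffree Uu)).
by rewrite mul0mx.
Qed.

End NoNullity.
End Hyper.
End Model.

(** * The affine charts in real coordinates *)

Section Affine.
Variables (R : realType) (n : nat) (c : R) (j : 'I_n.+1).
Hypothesis c0 : c != 0.
Implicit Types (x y : 'rV[R]_(n + n)).

(** The signs of the Hermitian form on [C^(n+1)]. *)
Definition sign_coef (l : 'I_n.+1) : R := if l == ord0 then 1 else Num.sg c.
Definition sign_block : 'M[R]_n := diag_mx (\row_l sign_coef (lift j l)).
(** The real part of the Hermitian form on the hyperplane [z_j = 0]. *)
Definition sign_form : 'M[R]_(n + n) := block_mx sign_block 0 0 sign_block.
Definition complex_unit : 'M[R]_(n + n) := block_mx 0 1%:M (- 1%:M) 0.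

Lemma cstructE : (@cstruct R n) = (fun w => w *m complex_unit).
Proof.
apply/funext => w; rewrite -[in RHS](hsubmxK w) mul_row_block.
by rewrite !mulmx0 add0r addr0 mulmx1 mulmxN mulmx1.
Qed.

Lemma sign_coef_sqr l : sign_coef l * sign_coef l = 1.
Proof.
rewrite /sign_coef; case: ifP => _; first by rewrite mulr1.
by rewrite -expr2 sqr_sg c0.
Qed.

Lemma sign_coef_neq0 l : sign_coef l != 0.
Proof.
apply/eqP => h; have := sign_coef_sqr l; rewrite h mul0r => /esym/eqP.
by rewrite oner_eq0.
Qed.

Lemma complex_unit_sqr : complex_unit *m complex_unit = - 1%:M.
Proof.
rewrite mulmx_block !(mul0mx, mulmx0, mulmx1, mul1mx, addr0, add0r).
by rewrite [in RHS]scalar_mx_block opp_block_mx !oppr0.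
Qed.

Lemma sign_form_sym : sign_form^T = sign_form.
Proof. by rewrite tr_block_mx !trmx0 tr_diag_mx. Qed.

Lemma complex_unit_isometry :
  complex_unit *m sign_form *m complex_unit^T = sign_form.
Proof.
rewrite tr_block_mx !trmx0 linearN /= trmx1 !mulmx_block.
rewrite !(mul0mx, mulmx0, mulmx1, mul1mx, addr0, add0r).
by rewrite !(mulNmx, mul1mx, mulmxN, mulmx1, opprK, oppr0).
Qed.

Lemma sign_form_unit : sign_form \in unitmx.
Proof.
have s2 : sign_block *m sign_block = 1%:M.
  apply/matrixP => a b; rewrite mul_diag_mx !mxE.
  by case: eqVneq => [->|_]; rewrite ?mulr0n ?mulr0 // mulr1n sign_coef_sqr.
have : sign_form *m sign_form = 1%:M.
  rewrite mulmx_block !(mul0mx, mulmx0, addr0, add0r) s2.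
  exact/esym/scalar_mx_block.
by case/mulmx1_unit.
Qed.

Lemma ip_sign_form x y : ip sign_form x y = \sum_l sign_coef (lift j l) *
  (x 0 (lshift n l) * y 0 (lshift n l) + x 0 (rshift n l) * y 0 (rshift n l)).
Proof.
rewrite /ip -[x in LHS]hsubmxK mul_row_block !(mulmx0, addr0, add0r).
rewrite -[y in LHS]hsubmxK tr_row_mx mul_row_col !mxE -big_split /=.
by apply: eq_bigr => l _; rewrite !mul_mx_diag !mxE; ring.
Qed.

Lemma mul_complex_unit x : x *m complex_unit = row_mx (- rsubmx x) (lsubmx x).
Proof. by rewrite -[RHS]/(cstruct x) cstructE. Qed.

(** The imaginary part of a Hermitian form is its real part with one argument
    multiplied by [i]. *)
Lemma herm_insert a b x y : herm c (insert j a x) (insert j b y) =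
  (sign_coef j)%:C * a * b^* +
    (ip sign_form x y +i* ip sign_form x (y *m complex_unit)).
Proof.
rewrite /herm (bigD1_ord j) //= /insert; congr (_ + _).
  by rewrite !mxE unlift_none /sign_coef; case: ifP.
rewrite !ip_sign_form mul_complex_unit.
have -> : forall (f g : 'I_n -> R),
    (\sum_l f l) +i* (\sum_l g l) = \sum_l (f l +i* g l).
  move=> f g; apply/eqP; rewrite eq_complex; apply/andP; split.
    by rewrite raddf_sum.
  by rewrite raddf_sum.
apply: eq_bigr => l _; rewrite row_mxEl row_mxEr !mxE !liftK.
have -> : (if lift j l == ord0 then 1 else (Num.sg c)%:C) =
    (sign_coef (lift j l))%:C.
  by rewrite /sign_coef; case: ifP.
apply/eqP; rewrite eq_complex /=; apply/andP; split; apply/eqP; ring.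
Qed.

Lemma herm_insert_gt0 x :
  (0 < herm c (insert j 1 x) (insert j 1 x)) =
  (0 < rho sign_form (sign_coef j) x).
Proof.
rewrite herm_insert (ipxJx complex_unit_sqr sign_form_sym complex_unit_isometry).
rewrite mulr1 conjC1 mulr1 ltcE /=.
by rewrite addr0 eqxx.
Qed.

Lemma Re_div_real (w : R[i]) (k : R) : complex.Re (w / k%:C) = complex.Re w / k.
Proof.
have -> : (k%:C)^-1 = (k^-1)%:C by rewrite -[LHS](fmorphV (real_complex R)).
by case: w => a b /=; rewrite mulr0 subr0.
Qed.

Lemma space_form_metricE :
  space_form_metric c j = sfmetric complex_unit sign_form (sign_coef j) c.
Proof.
apply/funext => x; apply/matrixP => a b.
rewrite [RHS](_ : _ = ip (sfmetric complex_unit sign_form (sign_coef j) c x)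
    (delta_mx 0 a) (delta_mx 0 b)); last by rewrite ip_delta -rowE [RHS]mxE.
rewrite ip_sfmetric [LHS]mxE; congr (_ * _).
move: (delta_mx 0 a) (delta_mx 0 b) => v w.
have zz : herm c (insert j 1 x) (insert j 1 x) = (rho sign_form (sign_coef j) x)%:C.
  rewrite herm_insert.
  rewrite (ipxJx complex_unit_sqr sign_form_sym complex_unit_isometry).
  rewrite mulr1 conjC1 mulr1.
  by apply/eqP; rewrite eq_complex /= addr0 !eqxx.
have zz2 : herm c (insert j 1 x) (insert j 1 x) ^+ 2 =
    (rho sign_form (sign_coef j) x ^+ 2)%:C.
  by rewrite zz rmorphXn.
rewrite zz2 Re_div_real zz !herm_insert !(mulr0, mul0r, add0r, mulr1, conjC0) /=.
rewrite !mul0r subr0 -/(rho _ _ _) /hdlog /nform.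
have -> : ip sign_form v x = ip sign_form x v by exact: (ipE_sym sign_form_sym).
have -> : ip sign_form v (x *m complex_unit) = - ip sign_form x (v *m complex_unit).
  by rewrite -(ipJl complex_unit_sqr complex_unit_isometry) (ipE_sym sign_form_sym).
move: (rho _ _ _) (ip sign_form v w) (ip sign_form x v) (ip sign_form x w)
  (ip sign_form x (v *m _)) (ip sign_form x (w *m _)) => r s1 s2 s3 s4 s5.
(* If [rho] vanishes both sides are 0, since the inverse of 0 is 0. *)
have [->|r0] := eqVneq r 0; last by field.
by rewrite expr2 !mulr0 !invr0 !mulr0 !subr0.
Qed.

Section Dictionary.
Variables (m : nat) (F N : 'rV[R]_m -> 'rV[R]_(n + n)).

Lemma xiE :
  xi (space_form_metric c j) F N = xiJ complex_unit sign_form (sign_coef j) c F N.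
Proof. by apply/funext => u; rewrite /xi /xiJ cstructE space_form_metricE. Qed.

Lemma etaE : Defs.eta (space_form_metric c j) F N =
  etaJ complex_unit sign_form (sign_coef j) c F N.
Proof.
by apply/funext => u; apply/funext => v; rewrite /Defs.eta /etaJ xiE space_form_metricE.
Qed.

Lemma phiE :
  phi (space_form_metric c j) F = phiJ complex_unit sign_form (sign_coef j) c F.
Proof.
apply/funext => u; apply/funext => v.
by rewrite /phi /phiJ cstructE space_form_metricE.
Qed.

End Dictionary.

End Affine.

(** The coordinate map is a total function that picks a preimage in the domain of
    the chart whenever there is one. *)
Lemma coord_dom (R : realType) (m : nat) (T : Type) (X : atlas R m T)
    (i : chart X) (P : T) : chart_image i P -> dom X i (Defs.coord i P).
Proof.
move=> PX; have sP : set_surj (dom X i) (chart_image i) (param X i) by [].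
exact: (surjpinv_image_sub (dflt := fun=> 0) sP (imageP _ PX)).
Qed.

(** Scale a representative of the line so that one of its nonzero components
    becomes 1. *)
Lemma space_form_cover (R : realType) (c : R) (n : nat) (P : space_form c n) :
  exists j : chart (space_form_atlas c n), chart_image j P.
Proof.
case: P => L HL; have [z [zpos Lz]] := HL.
have [j zj] : exists j, z 0 j != 0.
  apply/existsP; apply: contraT => /existsPn z0.
  have z00 : z = 0 by apply/rowP => k; rewrite mxE; have /negPn/eqP := z0 k.
  move: zpos; rewrite z00 /herm big1 ?ltxx // => k _.
  by rewrite mxE mulr0 mul0r.
pose w := (z 0 j)^-1 *: z.
have wpos : 0 < herm c w w.
  have -> : herm c w w = `|(z 0 j)^-1| ^+ 2 * herm c z z.
    rewrite /herm mulr_sumr; apply: eq_bigr => k _.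
    rewrite /w !mxE rmorphM normCK /=; ring.
  by rewrite mulr_gt0 // exprn_gt0 // normr_gt0 invr_eq0.
pose x : 'rV[R]_(n + n) := row_mx (\row_l complex.Re (w 0 (lift j l)))
  (\row_l complex.Im (w 0 (lift j l))).
have wx : insert j 1 x = w.
  apply/rowP => k; rewrite mxE; case: unliftP => [l ->|->].
    by rewrite /x row_mxEl row_mxEr !mxE; case: (_ * _).
  by rewrite /w mxE mulVf.
exists j; exists x; first by rewrite /= wx.
rewrite /= wx /mkpoint; case: pselect => // h.
rewrite /point_of_line; apply: eq_exist; rewrite Lz.
apply/seteqP; split => _ [a _ <-].
  by exists (a * (z 0 j)^-1) => //; rewrite /w scalerA.
by exists (a * z 0 j) => //; rewrite /w scalerA mulfK.
Qed.

(** * Non-existence of the hypersurface *)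

Theorem theorem1p4 (R : realType) (n : nat) (c : R) (hn : (2 <= n)%N)
    (hc : c != 0) :
  ~ exists (T : topologicalType) (X : atlas R n.*2.-1 T)
      (f : T -> space_form c n)
      (N : chart (space_form_atlas c n) -> T -> 'rV[R]_(n + n))
      (kappa mu nu : T -> R),
    [/\ real_hypersurface X f N,
        [/\ smooth_fun X kappa, smooth_fun X mu & smooth_fun X nu],
        [/\ nonconstant kappa, nonconstant mu & nonconstant nu]
      & xi_in_nullity X f N kappa mu nu].
Proof.
case=> T [X [f [N [kappa [mu [nu
  [[Xman _ fsm Nfield imm] [_ _ nusm] [_ _ nunc] nul]]]]]]].
have [P nuP] : exists P, nu P != 0.
  have [P [Q PQ]] := nunc; have [P0|] := eqVneq (nu P) 0; last by exists P.
  by exists Q; apply/eqP => Q0; apply: PQ; rewrite P0 Q0.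
have [_ _ Xcover _ _] := Xman.
have [i [u0 iu0 u0P]] := Xcover P.
have [j fPj] := space_form_cover (f P).
have [oL sF] := fsm i j; have [_ /(_ i j) sN] := Nfield.
(* The part of the domain common to the two charts on which [nu] is nonzero;
   the interior makes it open by construction. *)
pose nz : set 'rV[R]_(n.*2.-1) := [set u | nu (param X i u) != 0].
pose U := locdom f i j `&` nz°.
have oU : open U by apply: openI => //; exact: open_interior.
have UL : U `<=` locdom f i j by move=> u [].
have Uu0 : U u0.
  split; first by split=> //=; rewrite u0P.
  have cnu := smooth_continuous (nusm i) iu0.
  apply: (cnu [set r | r != 0]).
  by apply: open_nbhs_nbhs; split; [exact: open_neq | rewrite /= u0P].
have km : (n + n)%N = (n.*2.-1).+1.
  by rewrite addnn prednK // double_gt0 (ltn_trans _ hn).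
have dbl q : (2 <= q)%N -> (1 < q.*2.-1)%N by case: q => [|[|q]].
have m1 := dbl n hn.
have rpos u : U u -> rho (sign_form c j) (sign_coef c j) (locrep f i j u) != 0.
  move=> /UL[_ fu]; have := coord_dom fu; rewrite /= herm_insert_gt0.
  by move/lt0r_neq0.
have sfE := space_form_metricE c j.
have imm' u (Uu : U u) := imm i j u (UL u Uu).
have nul' u (Uu : U u) := nul i j u (UL u Uu).
rewrite /= sfE in imm'.
have nuU u : U u -> nu (param X i u) != 0 by case=> _ /interior_subset.
apply: (@no_nullity R n (complex_unit R n) (sign_form c j) (sign_coef c j) c
  (complex_unit_sqr R n) (sign_form_sym c j) (complex_unit_isometry c j)
  (sign_form_unit j hc) (sign_coef_neq0 hc j) hc
  _ U (locrep f i j) (fun u => N j (param X i u)) oU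
  (smooth_subset UL sF) (smooth_subset UL sN) km rpos _ _ _
  (fun u => kappa (param X i u)) (fun u => mu (param X i u))
  (fun u => nu (param X i u)) m1 nuU _ u0 Uu0).
- by move=> u /imm' [].
- by move=> u /imm' [].
- by move=> u /imm' [].
- move=> u /nul'; rewrite /nullity xiE etaE phiE sfE => h v w; exact: h.
Qed.
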